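(* Let $m:\mathbb{R}^c\to\mathbb{R}$ be a merging function and let $\phi$ be a kernel such that $b_k(\phi)>0$ for all $k\ge1$. Then the test based on $T_{N,c}^{\phi,m}$ that rejects for large values is consistent against the fixed alternatives $\mathcal{H}_{1,\mathrm{fix}}$; that is, whenever $(\mathrm{P}_1,\ldots,\mathrm{P}_c)$ is such that $\mathrm{P}_i\ne\mathrm{P}_j$ for some $i\neq j$, one has $$\mathrm{P}\big(T_{N,c}^{\phi,m}>t\big)\to1\quad\text{as }N\to\infty,\text{ for every }t\in\mathbb{R}.$$
   Context: Setting. Fix $c\ge2$ and absolutely continuous distributions $\mathrm{P}_1,\ldots,\mathrm{P}_c$ on the circle that do not depend on $N$. For $\ell=1,\ldots,c$, the $\ell$th sample consists of angles $\Theta_1^{(\ell)},\ldots,\Theta_{n_\ell}^{(\ell)}\in[0,2\pi)$, each with distribution $\mathrm{P}_\ell$; all observations (within and across samples) are mutually independent. $n_\ell\ge2$ for all $\ell$ and $N:=\sum_{\ell=1}^c n_\ell$. $\mathcal{H}_{1,\mathrm{fix}}:=\{(\mathrm{P}_1,\ldots,\mathrm{P}_c):\exists\, i\ne j\text{ such that }\mathrm{P}_i\ne\mathrm{P}_j\}$. Uniform scores. $r_i^{(\ell)}\in\{1,\ldots,N\}$ is the rank of $\Theta_i^{(\ell)}$ in the pooled sample of size $N$ (ties have probability zero) and $c_i^{(\ell)}:=2\pi r_i^{(\ell)}/N$ is its uniform score; $\mathbf{c}^{(\ell)}:=(c_1^{(\ell)},\ldots,c_{n_\ell}^{(\ell)})$.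 Kernel. $\phi:[-1,1]\to\mathbb{R}$ is square integrable with respect to the weight $(1-t^2)^{-1/2}$, with Chebyshev coefficients $b_k(\phi)=\frac{2}{\pi(1+\delta_{k0})}\int_{-1}^1\phi(t)\cos(k\cos^{-1}t)(1-t^2)^{-1/2}\,\mathrm{d}t$ satisfying $b_0(\phi)=0$ and $\sum_{k\ge1}|b_k(\phi)|<\infty$, and $\phi(\cos\theta)=\sum_{k\ge1}b_k(\phi)\cos(k\theta)$ for all $\theta$ (so $\phi$ is continuous). Statistics. $S_{n_\ell}^\phi(\mathbf{c}^{(\ell)}):=\frac1{n_\ell}\sum_{i,j=1}^{n_\ell}\phi(\cos(c_i^{(\ell)}-c_j^{(\ell)}))$ and $T_{N,c}^{\phi,m}:=m\big(S_{n_1}^\phi(\mathbf{c}^{(1)}),\ldots,S_{n_c}^\phi(\mathbf{c}^{(c)})\big)$. Merging function. A merging function is a (componentwise) increasing map $m:\mathbb{R}^c\to\mathbb{R}$ such that: (M1) there is $L>0$ with $|m(\mathbf{x})-m(\mathbf{y})|\le L\|\mathbf{x}-\mathbf{y}\|_\infty$ for all $\mathbf{x},\mathbf{y}\in\mathbb{R}^c$; (M2) there is a function $m_\infty:\mathbb{R}^c\to\mathbb{R}$ with $\lim_{N\to\infty}N^{-1}m(N\mathbf{x})=m_\infty(\mathbf{x})$ for all $\mathbf{x}\in\mathbb{R}^c$; (M3) $m_\infty(\mathbf{x})>0$ for all $\mathbf{x}\in[0,\infty)^c$ for which there are two distinct indices $\ell_1,\ell_2$ with $x_{\ell_1}>0$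 and $x_{\ell_2}>0$; (M4) if $x_\ell<y_\ell$ for every $\ell=1,\ldots,c$, then $m(\mathbf{x})<m(\mathbf{y})$. Asymptotic regime. $N\to\infty$ with $c$ fixed and $\pi_{\ell,N}:=n_\ell/N\to\pi_\ell\in(0,1)$ for all $\ell=1,\ldots,c$. *)

(* Defs.v *)
From HB Require Import structures.
From mathcomp Require Import all_boot all_order all_algebra.
From mathcomp Require Import all_classical all_reals all_analysis.

Set Implicit Arguments.
Unset Strict Implicit.
Unset Printing Implicit Defensive.

Import Order.TTheory GRing.Theory Num.Theory.
Import numFieldNormedType.Exports.

Local Open Scope classical_set_scope.
Local Open Scope ring_scope.

(* A distribution on the circle is a probability measure on the Borel sets of R
   carried by the interval [0, 2 pi[ of angles; arc length is then Lebesgue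
   measure. *)
Definition ac_circular {R : realType}
    (Q : probability (measurableTypeR R) R) : Prop :=
  Q `[0, 2 * pi[%classic = 1%E /\ Q `<< (@lebesgue_measure R).

(* Two probability measures differ when they disagree on a measurable set;
   their values as functions on non-measurable sets are irrelevant. *)
Definition same_law {d} {T : measurableType d} {R : realType}
    (mu nu : set T -> \bar R) : Prop :=
  forall A : set T, measurable A -> mu A = nu A.

Definition H1_fix {R : realType} (c : nat)
    (Q : 'I_c -> probability (measurableTypeR R) R) : Prop :=
  exists i j : 'I_c, i != j /\ ~ same_law (Q i) (Q j).

Definition mutually_independent {d} {T : measurableType d} {R : realType}
    (P : probability T R) (I : finType) (X : I -> {RV P >-> R}) : Prop :=
  forall (J : {set I}) (B : I -> set R), (forall i, measurable (B i)) ->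
    P (\bigcap_(i in [set` J]) (X i @^-1` B i)) =
      (\prod_(i in J) P (X i @^-1` B i))%E.

(* Independence is across all c samples jointly: the pairs (l, i) with
   i < n l are the indices of the pooled sample. *)
Definition circular_samples {d} {T : measurableType d} {R : realType}
    (P : probability T R) (c : nat) (n : 'I_c -> nat)
    (Q : 'I_c -> probability (measurableTypeR R) R)
    (Theta : forall l : 'I_c, 'I_(n l) -> {RV P >-> R}) : Prop :=
  [/\ forall l i w, Theta l i w \in `[0, 2 * pi[,
      forall l i, same_law (distribution P (Theta l i)) (Q l)
    & mutually_independent
        (fun s : {l : 'I_c & 'I_(n l)} => Theta (tag s) (tagged s))].

Definition pooled_size (c : nat) (n : 'I_c -> nat) : nat :=
  (\sum_(l < c) n l)%N.

(* The rank is the number of pooled observations that are at most x l i; it is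
   the usual rank in 1, ..., N when there are no ties. *)
Definition pooled_rank {R : realType} (c : nat) (n : 'I_c -> nat)
    (x : forall l : 'I_c, 'I_(n l) -> R) (l : 'I_c) (i : 'I_(n l)) : nat :=
  (\sum_(l' < c) #|[pred j : 'I_(n l') | (x l' j <= x l i)%R]|)%N.

Definition uniform_score {R : realType} (c : nat) (n : 'I_c -> nat)
    (x : forall l : 'I_c, 'I_(n l) -> R) (l : 'I_c) (i : 'I_(n l)) : R :=
  2 * pi * (pooled_rank x i)%:R / (pooled_size n)%:R.

Definition cheb_coef {R : realType} (phi : R -> R) (k : nat) : R :=
  2 / (pi * (1 + (k == 0%N)%:R)) *
  Rintegral (@lebesgue_measure R) `[-1, 1]%classic
    (fun t => phi t * cos (k%:R * acos t) / Num.sqrt (1 - t ^+ 2)).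

(* Only the values of phi on [-1, 1] are constrained or used. *)
Record is_kernel {R : realType} (phi : R -> R) : Prop := IsKernel {
  kernel_measurable : measurable_fun (`[-1, 1]%classic : set R) phi ;
  kernel_square_integrable : (@lebesgue_measure R).-integrable `[-1, 1]%classic
    (fun t => (phi t ^+ 2 / Num.sqrt (1 - t ^+ 2))%:E) ;
  kernel_coef0 : cheb_coef phi 0 = 0 ;
  kernel_summable : cvgn (series (fun k => `|cheb_coef phi k.+1|)) ;
  kernel_expansion : forall theta : R,
    series (fun k => cheb_coef phi k.+1 * cos (k.+1%:R * theta)) @ \oo -->
      phi (cos theta) }.

Definition S_stat {R : realType} (phi : R -> R) (n : nat) (u : 'I_n -> R) : R :=
  n%:R^-1 * \sum_(i < n) \sum_(j < n) phi (cos (u i - u j)).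

Definition T_stat {R : realType} (c : nat) (phi : R -> R) (m : 'rV[R]_c -> R)
    (n : 'I_c -> nat) (x : forall l : 'I_c, 'I_(n l) -> R) : R :=
  m (\row_l S_stat phi (uniform_score x (l := l))).

(* "Increasing" is meant in the weak sense, strictness being governed by
   merging_strict; the norm on row vectors is the maximum norm. *)
Record is_merging {R : realType} (c : nat) (m : 'rV[R]_c -> R) : Prop :=
  IsMerging {
    merging_increasing : forall x y : 'rV[R]_c,
      (forall l, x 0 l <= y 0 l) -> m x <= m y ;
    merging_lipschitz : exists2 L : R, 0 < L &
      forall x y : 'rV[R]_c, `|m x - m y| <= L * `|x - y| ;
    merging_limit : exists2 m_oo : 'rV[R]_c -> R,
      forall x : 'rV[R]_c, (fun N : nat => N%:R^-1 * m (N%:R *: x)) @ \oo --> m_oo x &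
      forall x : 'rV[R]_c, (forall l, 0 <= x 0 l) ->
        (exists l1 l2, [/\ l1 != l2, 0 < x 0 l1 & 0 < x 0 l2]) ->
        0 < m_oo x ;
    merging_strict : forall x y : 'rV[R]_c,
      (forall l, x 0 l < y 0 l) -> m x < m y }.

(* Main.v *)
Require Import Defs.
From HB Require Import structures.
From mathcomp Require Import all_boot all_order all_algebra.
From mathcomp Require Import all_classical all_reals all_analysis.
From mathcomp Require Import measurable_realfun.
From mathcomp Require Import ring lra.

Set Implicit Arguments.
Unset Strict Implicit.
Unset Printing Implicit Defensive.

Import Order.TTheory GRing.Theory Num.Theory.
Import numFieldNormedType.Exports.

Local Open Scope classical_set_scope.
Local Open Scope ring_scope.

(** Consistency of the tests based on uniform scores.

    Let [F = \sum_l p l * F_l] be the distribution function of the limiting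
    pooled law. It is continuous, so [F] is uniformly distributed under the
    mixture (probability integral transform, [mix_prob_lt]). The uniform score of
    an observation is [2 * pi] times the pooled empirical distribution function
    at that observation, hence close to [2 * pi * F]. Therefore the empirical
    trigonometric moments of the scores of sample [l] converge in probability to
    the Fourier coefficients of the law of [F] under [Q l] ([fourier] below).

    If all those coefficients of positive frequency vanish for some [l], then [F]
    is uniform under [Q l] too ([fourier_uniqueness]), which forces [F_l = F]
    ([fourier_eq0_distr_fun]). The mixture of the coefficients over [l] is always
    zero ([mix_fourier_eq0]). So under the alternative at least two of the laws
    have a nonzero coefficient ([two_nonzero_fourier]): if all coefficients
    vanished all the laws would coincide, and a single exception is impossible
    because of the mixture.

    Since every Chebyshev coefficient of the kernel is positive, each statistic
    [S_stat] is nonnegative and dominates the sample size times a positive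
    multiple of any squared empirical moment ([S_stat_ge]). Two of the statistics
    thus grow at least linearly with the pooled sample size [N], with probability
    tending to one, and the behaviour of the merging function along the ray
    [N *: v], for [v] with two positive coordinates, sends the test statistic to
    infinity ([merging_divergence]).

    The convergence in probability is obtained by finitely many instances of the
    weak law of large numbers. The circle is cut into the cells
    [j / M <= F < (j + 1) / M]; once the observed frequencies of all cells are
    close to their probabilities ([frequency_deviation], Chebyshev's inequality),
    a deterministic estimate controls both the ranks and the trigonometric
    moments ([empirical_fourier]). *)

(** * Probabilities as real numbers and the weak law for frequencies *)

Section RealProbability.
Context d (T : measurableType d) (R : realType) (P : probability T R).

Definition prob (A : set T) : R := fine (P A).

Lemma probE A : measurable A -> P A = (prob A)%:E.
Proof. by move=> mA; rewrite /prob fineK// fin_num_measure. Qed.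

Lemma prob_ge0 A : 0 <= prob A.
Proof. by rewrite fine_ge0// measure_ge0. Qed.

Lemma prob_le1 A : measurable A -> prob A <= 1.
Proof. by move=> mA; rewrite -lee_fin -probE// probability_le1. Qed.

Lemma prob_setT : prob setT = 1.
Proof. by rewrite /prob probability_setT. Qed.

Lemma prob_le A B : measurable A -> measurable B -> A `<=` B ->
  prob A <= prob B.
Proof.
by move=> mA mB AB; rewrite -lee_fin -!probE// le_measure// inE.
Qed.

Lemma prob_setC A : measurable A -> prob (~` A) = 1 - prob A.
Proof.
move=> mA; apply: EFin_inj; rewrite -probE; last exact: measurableC.
by rewrite probability_setC// EFinB probE.
Qed.

Lemma prob_setDS A B : measurable A -> measurable B -> A `<=` B ->
  prob (B `\` A) = prob B - prob A.
Proof.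
move=> mA mB AB; apply: EFin_inj.
rewrite -probE; last exact: measurableD.
rewrite measureD//; last first.
  by rewrite (le_lt_trans (probability_le1 _ _))// ltry.
by rewrite setIidr// EFinB -!probE.
Qed.

Lemma prob_setU_le A B : measurable A -> measurable B ->
  prob (A `|` B) <= prob A + prob B.
Proof.
move=> mA mB; rewrite -lee_fin EFinD -!probE//; last exact: measurableU.
exact: measureU2.
Qed.

Lemma prob_bigsetU_le (I : finType) (A : I -> set T) :
  (forall i, measurable (A i)) ->
  prob (\big[setU/set0]_(i : I) A i) <= \sum_(i : I) prob (A i).
Proof.
move=> mA; have mU (r : seq I) : measurable (\big[setU/set0]_(i <- r) A i).
  exact: bigsetU_measurable.
elim: (index_enum I) => [|i r IH]; first by rewrite !big_nil /prob measure0.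
rewrite !big_cons; apply: le_trans (lerD (lexx _) IH).
exact: prob_setU_le.
Qed.

Definition bounded_mfun (f : T -> R) :=
  measurable_fun setT f /\ exists M : R, forall x, `|f x| <= M.

Lemma bounded_mfun_integrable f : bounded_mfun f ->
  P.-integrable setT (EFin \o f).
Proof.
move=> [mf [M fM]]; apply: measurable_bounded_integrable => //.
  by rewrite (le_lt_trans (probability_le1 _ _)) ?ltry.
exists M; split; first exact: num_real.
by move=> y My x _; exact: le_trans (fM x) (ltW My).
Qed.

Lemma bounded_mfun_cst r : bounded_mfun (fun=> r).
Proof. by split; [exact: measurable_cst|exists `|r|]. Qed.

Lemma bounded_mfunD f g : bounded_mfun f -> bounded_mfun g ->
  bounded_mfun (fun x => f x + g x).
Proof.
move=> [mf [M fM]] [mg [N gN]]; split; first exact: measurable_funD.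
by exists (M + N) => x; rewrite (le_trans (ler_normD _ _))// lerD.
Qed.

Lemma bounded_mfunM f g : bounded_mfun f -> bounded_mfun g ->
  bounded_mfun (fun x => f x * g x).
Proof.
move=> [mf [M fM]] [mg [N gN]]; split; first exact: measurable_funM.
by exists (M * N) => x; rewrite normrM ler_pM.
Qed.

Lemma bounded_mfun_sum (I : Type) (r : seq I) (f : I -> T -> R) :
  (forall i, bounded_mfun (f i)) -> bounded_mfun (fun x => \sum_(i <- r) f i x).
Proof.
move=> bf; elim: r => [|i r IH].
  by under eq_fun do rewrite big_nil; exact: bounded_mfun_cst.
by under eq_fun do rewrite big_cons; exact: bounded_mfunD.
Qed.

Lemma bounded_mfun_indic A : measurable A ->
  bounded_mfun (\1_A : T -> R).
Proof.
move=> mA; split; first exact: measurable_indic.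
by exists 1 => x; rewrite indicE; case: (_ \in _); rewrite ?normr1 ?normr0.
Qed.

Lemma Rintegral_cstT r : \int[P]_x r = r.
Proof. by rewrite Rintegral_cst// [fine _]prob_setT mulr1. Qed.

Lemma Rintegral_indic A : measurable A -> \int[P]_x \1_A x = prob A.
Proof. by move=> mA; rewrite /Rintegral integral_indic// setIT. Qed.

Lemma Rintegral_sum (I : Type) (r : seq I) (f : I -> T -> R) :
  (forall i, bounded_mfun (f i)) ->
  \int[P]_x (\sum_(i <- r) f i x) = \sum_(i <- r) \int[P]_x f i x.
Proof.
move=> bf; elim: r => [|i r IH].
  by under eq_Rintegral do rewrite big_nil; rewrite big_nil Rintegral_cstT.
under eq_Rintegral do rewrite big_cons.
rewrite big_cons RintegralD// ?IH//; apply: bounded_mfun_integrable => //.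
exact: bounded_mfun_sum.
Qed.

Lemma le_norm_Rintegral_dist f g e : bounded_mfun f -> bounded_mfun g ->
  (forall x, `|f x - g x| <= e) ->
  `|\int[P]_x f x - \int[P]_x g x| <= e.
Proof.
move=> bf bg fge; have bN : bounded_mfun (fun x => f x - g x).
  have := bounded_mfunD bf (bounded_mfunM (bounded_mfun_cst (-1)) bg).
  by under eq_fun do rewrite mulN1r.
rewrite -RintegralB//; try exact: bounded_mfun_integrable.
apply: le_trans (le_normr_Rintegral _ (bounded_mfun_integrable bN)) _ => //.
rewrite -[leRHS]Rintegral_cstT; apply: le_Rintegral => //.
- by apply: integrable_norm; exact: bounded_mfun_integrable.
- by apply: bounded_mfun_integrable; exact: bounded_mfun_cst.
Qed.

(** Rounding [f] to the value [h j] on the cell [B j] of a finite partition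
    gives a Riemann-Stieltjes sum for its integral. *)
Lemma Rintegral_rounding (M : nat) (J : T -> 'I_M) (h : 'I_M -> R) f e :
  (forall j, measurable (J @^-1` [set j])) -> bounded_mfun f ->
  (forall x, `|f x - h (J x)| <= e) ->
  `|\int[P]_x f x - \sum_j h j * prob (J @^-1` [set j])| <= e.
Proof.
move=> mJ bf fe.
have bi j : bounded_mfun (fun x => h j * \1_(J @^-1` [set j]) x).
  apply: bounded_mfunM; first exact: bounded_mfun_cst.
  exact: bounded_mfun_indic.
have -> : \sum_j h j * prob (J @^-1` [set j]) =
    \int[P]_x \sum_j (h j * \1_(J @^-1` [set j]) x).
  rewrite Rintegral_sum//; apply: eq_bigr => j _.
  rewrite RintegralZl// ?Rintegral_indic//.
  by apply: bounded_mfun_integrable; exact: bounded_mfun_indic.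
apply: le_norm_Rintegral_dist => //; first exact: bounded_mfun_sum.
move=> x; rewrite (bigD1 (J x))//= big1 ?addr0.
  by rewrite indicE mem_set// mulr1.
move=> j jJ; rewrite indicE memNset ?mulr0//= => /eqP.
by rewrite eq_sym (negPf jJ).
Qed.

(** Pairwise independence makes the variance of the sum of the centred
    indicators linear in [n]; the bound is then Chebyshev's inequality, with
    [q - q ^+ 2] majorized by [1]. *)
Lemma frequency_deviation (n : nat) (A : 'I_n -> set T) (q e : R) :
  (0 < n)%N -> 0 < e -> (forall i, measurable (A i)) ->
  (forall i, prob (A i) = q) ->
  (forall i j, i != j -> prob (A i `&` A j) = q * q) ->
  prob [set w | e < `|n%:R^-1 * (\sum_i \1_(A i) w) - q|] <=
    (n%:R * e ^+ 2)^-1.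
Proof.
move=> n0 e0 mA Aq Aqq.
have n0R : 0 < n%:R :> R by rewrite ltr0n.
pose Y w := \sum_i (\1_(A i) w - q).
have bY1 i : bounded_mfun (fun w => \1_(A i) w - q).
  by apply: bounded_mfunD; [exact: bounded_mfun_indic|exact: bounded_mfun_cst].
have bY : bounded_mfun Y by exact: bounded_mfun_sum.
have YE w : n%:R^-1 * (\sum_i \1_(A i) w) - q = n%:R^-1 * Y w.
  rewrite /Y big_split/= sumr_const card_ord mulrDr.
  congr (_ + _); rewrite -[(- q) *+ _]mulr_natl mulrA mulVf ?mul1r//.
  by rewrite gt_eqF.
set D := [set w | _].
have DE : D = [set w | n%:R * e < `|Y w|].
  apply/seteqP; split=> w; rewrite /D /= YE normrM ger0_norm ?invr_ge0 ?ler0n//.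
    by rewrite mulrC ltr_pdivlMr// mulrC.
  by rewrite [in X in _ -> X]mulrC ltr_pdivlMr// [e * _]mulrC.
have mD : measurable D.
  rewrite DE -[X in measurable X]setTI.
  apply: (@measurable_fun_ltr _ _ _ _ (cst (n%:R * e)) (fun w => `|Y w|)) => //.
  - by apply: measurableT_comp => //; exact: bY.1.
have bY2 : bounded_mfun (fun w => Y w * Y w) by exact: bounded_mfunM.
have I2 : \int[P]_w (Y w * Y w) <= n%:R.
  have YY w : Y w * Y w = \sum_i \sum_j (\1_(A i `&` A j) w
      + (- q) * \1_(A i) w + (- q) * \1_(A j) w + q * q).
    rewrite /Y mulr_suml; apply: eq_bigr => i _.
    rewrite mulr_sumr; apply: eq_bigr => j _.
    by rewrite indicI /=; ring.
  have bij i j : bounded_mfun (fun w => \1_(A i `&` A j) w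
      + (- q) * \1_(A i) w + (- q) * \1_(A j) w + q * q).
    do ![apply: bounded_mfunD]; try exact: bounded_mfun_cst.
    - by apply: bounded_mfun_indic; exact: measurableI.
    - apply: bounded_mfunM; first exact: bounded_mfun_cst.
      exact: bounded_mfun_indic.
    - apply: bounded_mfunM; first exact: bounded_mfun_cst.
      exact: bounded_mfun_indic.
  under eq_Rintegral do rewrite YY.
  rewrite Rintegral_sum; last by move=> i; exact: bounded_mfun_sum.
  have -> : n%:R = \sum_(i < n) (1 : R) by rewrite sumr_const card_ord.
  apply: ler_sum => i _; rewrite Rintegral_sum//.
  have Eij j : \int[P]_w (\1_(A i `&` A j) w
      + (- q) * \1_(A i) w + (- q) * \1_(A j) w + q * q)
      = prob (A i `&` A j) - q * q.
    have b1 : bounded_mfun (\1_(A i `&` A j) : T -> R).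
      by apply: bounded_mfun_indic; exact: measurableI.
    have bq k : bounded_mfun (fun w => - q * \1_(A k) w).
      apply: bounded_mfunM; first exact: bounded_mfun_cst.
      exact: bounded_mfun_indic.
    rewrite RintegralD//; last 2 first.
    - by apply: bounded_mfun_integrable; do 2 apply: bounded_mfunD => //.
    - by apply: bounded_mfun_integrable; exact: bounded_mfun_cst.
    rewrite RintegralD//; last 2 first.
    - by apply: bounded_mfun_integrable; apply: bounded_mfunD => //.
    - exact: bounded_mfun_integrable.
    rewrite RintegralD//; try exact: bounded_mfun_integrable.
    rewrite Rintegral_cstT !RintegralZl//; try
      by apply: bounded_mfun_integrable; exact: bounded_mfun_indic.
    rewrite !Rintegral_indic//; last exact: measurableI.
    by rewrite !Aq; ring.
  rewrite (eq_bigr _ (fun j _ => Eij j)).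
  rewrite (bigD1 i)//= setIid Aq big1 ?addr0; last first.
    by move=> j ji; rewrite Aqq 1?eq_sym// subrr.
  have := prob_ge0 (A i); have := prob_le1 (mA i); rewrite Aq => q1 q0.
  by have := mulr_ge0 q0 q0; lra.
have : (n%:R * e) ^+ 2 * prob D <= \int[P]_w (Y w * Y w).
  rewrite -Rintegral_indic// -RintegralZl//; last first.
    by apply: bounded_mfun_integrable; exact: bounded_mfun_indic.
  apply: le_Rintegral => //; try exact: bounded_mfun_integrable.
    apply: bounded_mfun_integrable; apply: bounded_mfunM.
      exact: bounded_mfun_cst.
    exact: bounded_mfun_indic.
  move=> w _; rewrite indicE; have [|_] := boolP (w \in D).
    rewrite inE DE/= mulr1 => lY; rewrite -expr2 -(real_normK (num_real (Y w))).
    by apply: lerXn2r (ltW lY); rewrite ?nnegrE ?mulr_ge0// ltW.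
  by rewrite mulr0 -expr2 sqr_ge0.
move=> /le_trans/(_ I2) h.
rewrite -(ler_pM2l (_ : 0 < (n%:R * e) ^+ 2)); last first.
  by rewrite exprn_gt0// mulr_gt0.
apply: le_trans h _; rewrite exprMn.
rewrite le_eqVlt; apply/orP; left; apply/eqP.
by field; rewrite !gt_eqF.
Qed.

End RealProbability.

(** * The mixture distribution function *)

Section DistributionFunction.
Context (R : realType) (Q : probability (measurableTypeR R) R).

Definition distr_fun (x : R) : R := prob Q `]-oo, x].

Lemma ac_circular_atomless x : ac_circular Q -> prob Q [set x] = 0.
Proof.
move=> [_ ac]; rewrite /prob; suff -> : Q [set x] = 0%E by [].
move/null_content_dominatesP : ac; apply => //.
exact: lebesgue_measure_set1.
Qed.

Let negid : measurableTypeR R -> R := fun x => - x.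

Let negid_measurable : measurable_fun setT negid.
Proof. exact: oppr_measurable. Qed.

#[local] HB.instance Definition _ :=
  @isMeasurableFun.Build _ _ _ _ negid negid_measurable.

Let posid : measurableTypeR R -> R := idfun.

#[local] HB.instance Definition _ :=
  @isMeasurableFun.Build _ _ _ _ posid (@measurable_id _ _ setT).

(** Right continuity holds for every distribution function; left continuity is
    right continuity of the distribution function of the reflected law, which
    is [1 - distr_fun (- y)] because there are no atoms. *)
Lemma distr_fun_continuous : ac_circular Q -> continuous distr_fun.
Proof.
move=> acQ x; apply/left_right_continuousP; split; last first.
  have : fine (cdf (posid : {RV Q >-> R}) y) @[y --> x^'+] -->
      fine (cdf (posid : {RV Q >-> R}) x).
    apply: fine_cvg; rewrite fineK ?fin_num_measure//.
    exact: cdf_right_continuous.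
  exact.
have HG : fine (cdf (negid : {RV Q >-> R}) y) @[y --> (- x)^'+] -->
    fine (cdf (negid : {RV Q >-> R}) (- x)).
  apply: fine_cvg; rewrite fineK ?fin_num_measure//.
  exact: cdf_right_continuous.
have GE y : fine (cdf (negid : {RV Q >-> R}) y) = 1 - distr_fun (- y).
  rewrite /distr_fun -prob_setC// setCitvl.
  rewrite [LHS](_ : _ = prob Q `[- y, +oo[); last first.
    rewrite /prob /cdf /distribution /pushforward; congr (fine (Q _)).
    apply/seteqP; split => z; rewrite /= !in_itv/= /negid ?andbT.
      by rewrite lerNl.
    by rewrite lerNl.
  have -> : `[- y, +oo[%classic = [set - y] `|` `]- y, +oo[%classic.
    by rewrite setU1itv// bnd_simp.
  apply/EFin_inj; rewrite -!probE//; last exact: measurableU.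
  rewrite measureU//; last first.
    apply/disj_set2P/disj_setPS => z [/= ->].
    by rewrite in_itv/= ltxx.
  rewrite -[RHS]add0e; congr (_ + _)%E.
  apply: etrans (probE Q (measurable_set1 (- y))) _.
  by rewrite ac_circular_atomless.
apply/cvg_at_leftNP.
have := @cvgB _ _ _ _ _ _ _ _ _ (cvg_cst (1 : R)) HG.
rewrite GE opprK subKr => /(_ _ _) h; suff -> : distr_fun \o -%R =
  (fun=> 1) - (fun y => fine (cdf (negid : {RV Q >-> R}) y)) by [].
apply/funext => y.
by rewrite /= [RHS](_ : _ = 1 - fine (cdf (negid : {RV Q >-> R}) y))// GE subKr.
Qed.

End DistributionFunction.

Section Mixture.
Context (R : realType) (c : nat).
Context (Q : 'I_c -> probability (measurableTypeR R) R) (p : 'I_c -> R).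
Hypotheses (acQ : forall l, ac_circular (Q l)).
Hypotheses (p_gt0 : forall l, 0 < p l) (p_sum : \sum_l p l = 1).

Definition mix_prob (A : set R) : R := \sum_l p l * prob (Q l) A.

Definition mix_fun (x : R) : R := mix_prob `]-oo, x].

Lemma mix_prob_le A B : measurable A -> measurable B -> A `<=` B ->
  mix_prob A <= mix_prob B.
Proof.
move=> mA mB AB; apply: ler_sum => l _.
by rewrite ler_pM2l//; exact: prob_le.
Qed.

Lemma mix_prob_ge0 A : 0 <= mix_prob A.
Proof. by apply: sumr_ge0 => l _; rewrite mulr_ge0 ?prob_ge0// ltW. Qed.

Lemma mix_prob_setT : mix_prob setT = 1.
Proof. by rewrite -p_sum; apply: eq_bigr => l _; rewrite prob_setT mulr1. Qed.

Lemma mix_prob_le1 A : measurable A -> mix_prob A <= 1.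
Proof. by move=> mA; rewrite -mix_prob_setT mix_prob_le. Qed.

Lemma mix_prob_eq0 A l : mix_prob A = 0 -> prob (Q l) A = 0.
Proof.
move=> /psumr_eq0P => h; have /eqP : p l * prob (Q l) A = 0.
  by apply: h => // k _; rewrite mulr_ge0 ?prob_ge0// ltW.
by rewrite mulf_eq0 gt_eqF//= => /eqP.
Qed.

Lemma mix_prob_setDS A B : measurable A -> measurable B -> A `<=` B ->
  mix_prob (B `\` A) = mix_prob B - mix_prob A.
Proof.
move=> mA mB AB; rewrite /mix_prob -sumrB; apply: eq_bigr => l _.
by rewrite prob_setDS// mulrBr.
Qed.

Lemma mix_fun_nondecreasing : {homo mix_fun : x y / x <= y}.
Proof. by move=> x y xy; apply: mix_prob_le => //; exact: subitvPr. Qed.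

Lemma mix_fun_ge0 x : 0 <= mix_fun x. Proof. exact: mix_prob_ge0. Qed.

Lemma mix_fun_le1 x : mix_fun x <= 1. Proof. exact: mix_prob_le1. Qed.

Lemma mix_fun_measurable : measurable_fun setT mix_fun.
Proof.
by apply: nondecreasing_measurable => // x y; exact: mix_fun_nondecreasing.
Qed.

Lemma measurable_mix_fun_lt u : measurable [set x | mix_fun x < u].
Proof.
rewrite -[X in measurable X]setTI.
apply: (@measurable_fun_ltr _ _ _ _ mix_fun (cst u)) => //.
exact: mix_fun_measurable.
Qed.

Lemma measurable_mix_fun_le u : measurable [set x | mix_fun x <= u].
Proof.
rewrite -[X in measurable X]setTI.
apply: (@measurable_fun_ler _ _ _ _ mix_fun (cst u)) => //.
exact: mix_fun_measurable.
Qed.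

Lemma mix_fun_continuous : continuous mix_fun.
Proof.
move=> x; apply: cvg_big => [|l _]; first exact: add_continuous.
apply: cvgM; first exact: cvg_cst.
exact: distr_fun_continuous.
Qed.

(** Continuity and the intermediate value theorem give quantiles of every
    level, since all the mass sits on a bounded interval. *)
Lemma mix_fun_surjective u : 0 <= u <= 1 -> exists x, mix_fun x = u.
Proof.
move=> u01.
have prob_circle l : prob (Q l) `[0, 2 * pi[ = 1.
  by rewrite /prob (acQ l).1.
have F0 : mix_fun 0 = 0.
  rewrite /mix_fun /mix_prob big1// => l _.
  suff -> : prob (Q l) `]-oo, 0] = 0 by rewrite mulr0.
  apply/le_anti; rewrite prob_ge0 andbT.
  rewrite -[leRHS](ac_circular_atomless 0 (acQ l)).
  have mD : measurable (~` `[0, 2 * pi[%classic `|` [set 0] : set R).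
    by apply: measurableU => //; exact: measurableC.
  apply: (@le_trans _ _ (prob (Q l) (~` `[0, 2 * pi[%classic `|` [set 0]))).
    apply: prob_le => // x /=; rewrite !in_itv/= le_eqVlt => /predU1P[->|x0].
      by right.
    by left => /=; rewrite leNgt x0.
  apply: le_trans (prob_setU_le _ _ _) _ => //; first exact: measurableC.
  by rewrite prob_setC// prob_circle subrr add0r.
have F1 : mix_fun (2 * pi) = 1.
  rewrite /mix_fun /mix_prob -[RHS]p_sum; apply: eq_bigr => l _.
  suff -> : prob (Q l) `]-oo, 2 * pi] = 1 by rewrite mulr1.
  apply/le_anti; rewrite prob_le1//= -[leLHS](prob_circle l).
  apply: prob_le => //.
  by move=> x /=; rewrite !in_itv/= => /andP[_ /ltW].
have [x _ Fx] : exists2 x, x \in `[0, 2 * pi] & mix_fun x = u.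
  apply: IVT.
  - by rewrite mulr_ge0// pi_ge0.
  - by apply: continuous_subspaceT => x; exact: mix_fun_continuous.
  - by rewrite F0 F1 min_l// max_r.
by exists x.
Qed.

(** The probability integral transform: under the mixture, [mix_fun] is
    uniformly distributed on the unit interval. *)
Lemma mix_prob_lt u : 0 <= u <= 1 -> mix_prob [set x | mix_fun x < u] = u.
Proof.
move=> u01; have mlt := measurable_mix_fun_lt u.
apply/le_anti/andP; split.
  have [x Fx] := mix_fun_surjective u01.
  rewrite -[leRHS]Fx; apply: mix_prob_le => // y /= Fy.
  rewrite in_itv/= leNgt; apply/negP => /ltW/mix_fun_nondecreasing.
  by rewrite Fx leNgt Fy.
rewrite leNgt; apply/negP => lu.
set m := mix_prob _ in lu; have m0 : 0 <= m by exact: mix_prob_ge0.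
have [x Fx] : exists x, mix_fun x = (m + u) / 2.
  by apply: mix_fun_surjective; lra.
have : mix_fun x <= m.
  apply: mix_prob_le => // y /=; rewrite in_itv/= => /mix_fun_nondecreasing.
  by rewrite Fx => /le_lt_trans; apply; lra.
by rewrite Fx; lra.
Qed.

Lemma mix_prob_leq u : 0 <= u <= 1 -> mix_prob [set x | mix_fun x <= u] = u.
Proof.
move=> u01; have mle := measurable_mix_fun_le u.
apply/le_anti/andP; split; last first.
  rewrite -[leLHS](mix_prob_lt u01); apply: mix_prob_le => //.
    exact: measurable_mix_fun_lt.
  by move=> x /= /ltW.
rewrite leNgt; apply/negP => lu.
set m := mix_prob _ in lu; have m1 : m <= 1 by exact: mix_prob_le1.
have : m <= mix_prob [set x | mix_fun x < (m + u) / 2].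
  apply: mix_prob_le => //; first exact: measurable_mix_fun_lt.
  by move=> x /= /le_lt_trans; apply; lra.
by rewrite mix_prob_lt; lra.
Qed.

(** The fibers of [mix_fun] are null sets for each component, because they are
    null for the mixture and all the weights are positive. *)
Lemma prob_mix_fun_leE l u : 0 <= u <= 1 ->
  prob (Q l) [set x | mix_fun x <= u] = prob (Q l) [set x | mix_fun x < u].
Proof.
move=> u01; apply/eqP; rewrite -subr_eq0; apply/eqP.
have mle := measurable_mix_fun_le u; have mlt := measurable_mix_fun_lt u.
have sub : [set x | mix_fun x < u] `<=` [set x | mix_fun x <= u].
  by move=> x /= /ltW.
rewrite -prob_setDS//; apply: mix_prob_eq0.
by rewrite mix_prob_setDS// mix_prob_lt// mix_prob_leq// subrr.
Qed.

End Mixture.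

(** * Trigonometry and polynomial thresholds *)

Section Trigonometry.
Context (R : realType).
Implicit Types x y z u a b : R.

Lemma cos_lipschitz x y : `|cos x - cos y| <= `|x - y|.
Proof.
wlog xy : x y / x <= y.
  move=> H; have [/H//|/ltW/H] := leP x y.
  by rewrite distrC [leRHS]distrC.
move: xy; rewrite le_eqVlt => /predU1P[->|xy]; first by rewrite !subrr.
have [z _] := @MVT R cos (fun z => - sin z) x y xy (fun z _ => is_derive_cos z)
  (continuous_subspaceT (@continuous_cos R)).
move=> E; rewrite distrC E normrM normrN [leRHS]distrC.
by rewrite ler_piMl// sin_max.
Qed.

Lemma cosM2 x y : cos x * cos y = (cos (x + y) + cos (x - y)) / 2.
Proof. by rewrite cosD cosB; field. Qed.

(** Multiplying by [2 * sin (pi * k / M)] makes the sum telescope. *)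
Lemma sum_cos_roots (k M : nat) a : (0 < k < M)%N ->
  \sum_(j < M) cos (2 * pi * k%:R * (j%:R / M%:R) - a) = 0.
Proof.
move=> /andP[k0 kM].
have M0 : 0 < M%:R :> R by rewrite ltr0n (leq_trans _ kM).
set h : R := pi * k%:R / M%:R.
have h0 : 0 < sin h.
  apply: sin_gt0_pi; rewrite /h divr_gt0 ?mulr_gt0 ?pi_gt0 ?(ltr0n _ k)//=.
  by rewrite ltr_pdivrMr// ltr_pM2l ?pi_gt0// ltr_nat.
pose g (j : nat) : R := sin (2 * pi * k%:R * (j%:R / M%:R) - a - h).
have tel : \sum_(j < M)
    (2 * sin h * cos (2 * pi * k%:R * (j%:R / M%:R) - a)) = 0.
  transitivity (\sum_(0 <= j < M) (g j.+1 - g j)).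
    rewrite big_mkord; apply: eq_bigr => j _; rewrite /g.
    have -> : 2 * pi * k%:R * (j.+1%:R / M%:R) - a - h =
        (2 * pi * k%:R * (j%:R / M%:R) - a) + h.
      by rewrite -natr1 /h; field; rewrite gt_eqF.
    by rewrite sinD [sin (_ - h)]sinB; ring.
  rewrite telescope_sumr// /g mul0r mulr0 divff ?gt_eqF// mulr1.
  have -> : 2 * pi * k%:R - a - h = (0 - a - h) + (pi *+ 2) *+ k :> R.
    by rewrite -[in RHS]mulr_natr -[pi *+ 2]mulr_natl; ring.
  by rewrite (periodicn (@sinD2pi R)) subrr.
move/eqP: tel; rewrite -mulr_sumr mulf_eq0 => /orP[|/eqP//].
by rewrite mulf_eq0 pnatr_eq0/= gt_eqF.
Qed.

(** The next lemmas say that, for [z] in the unit interval,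
    [cos (2 * pi * z - pi * u)] exceeds [cos (pi * u)] exactly on the open arc
    [0 < z < u], with equality only for [z] equal to [0], [u] or [1]. *)
Lemma cos_arc0 u : cos (2 * pi * 0 - pi * u) = cos (pi * u).
Proof. by rewrite mulr0 sub0r cosN. Qed.

Lemma cos_arc1 u : cos (2 * pi * 1 - pi * u) = cos (pi * u).
Proof.
rewrite (_ : 2 * pi * 1 - pi * u = - (pi * u) + pi *+ 2); last first.
  by rewrite -mulr_natl; ring.
by rewrite cosD2pi cosN.
Qed.

Lemma cos_arcu u : cos (2 * pi * u - pi * u) = cos (pi * u).
Proof. by congr cos; ring. Qed.

Lemma cos_pi_lt x y : 0 <= x -> x < y -> y <= 1 -> cos (pi * y) < cos (pi * x).
Proof.
move=> x0 xy y1; have p0 := pi_gt0 R.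
have itv z : 0 <= z <= 1 -> pi * z \in `[0, pi].
  by move=> /andP[z0 z1]; rewrite in_itv/= mulr_ge0 ?ler_piMr// ltW.
by rewrite ltr_cos ?ltr_pM2l// itv//; lra.
Qed.

Lemma cos_arc_inside u z : u < 1 -> 0 < z < u ->
  cos (pi * u) < cos (2 * pi * z - pi * u).
Proof.
move=> u1 /andP[z0 zu].
rewrite (_ : 2 * pi * z - pi * u = pi * (2 * z - u)); last by ring.
rewrite -[ltRHS]cos_norm normrM gtr0_norm ?pi_gt0//.
by apply: cos_pi_lt => //; [rewrite ltr_norml; lra|lra].
Qed.

Lemma cos_arc_outside u z : 0 < u -> u < z < 1 ->
  cos (2 * pi * z - pi * u) < cos (pi * u).
Proof.
move=> u0 /andP[uz z1]; have [h|h] := leP (2 * z - u) 1.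
  rewrite (_ : 2 * pi * z - pi * u = pi * (2 * z - u)); last by ring.
  by apply: cos_pi_lt => //; lra.
rewrite (_ : _ - _ = - (pi * (2 - 2 * z + u)) + pi *+ 2); last first.
  by rewrite -[pi *+ 2]mulr_natl; ring.
by rewrite cosD2pi cosN; apply: cos_pi_lt; lra.
Qed.

End Trigonometry.

Section Threshold.
Context (R : realType).
Implicit Type t : R.

(** The polynomials [(1 - X ^+ n) ^+ (2 ^ n)] converge on the unit interval to
    the indicator of [t < 1 / 2]: Bernoulli's inequality gives
    [1 - (2 * t) ^+ n] as a lower bound and [(2 * t) ^- n] as an upper one. *)
Definition threshold n t : R := (1 - t ^+ n) ^+ (2 ^ n).

Lemma bernoulli_ineq (x : R) n : -1 <= x -> 1 + n%:R * x <= (1 + x) ^+ n.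
Proof.
move=> x1; elim: n => [|n IH]; first by rewrite mul0r addr0 expr0.
rewrite exprS; apply: le_trans (ler_wpM2l _ IH); last by lra.
rewrite -natr1; have := sqr_ge0 x; rewrite expr2 => xx.
have : 0 <= n%:R * (x * x) by rewrite mulr_ge0.
by nra.
Qed.

Lemma threshold_bounds n t : 0 <= t <= 1 -> 0 <= threshold n t <= 1.
Proof.
move=> /andP[t0 t1].
have : 0 <= t ^+ n <= 1 by rewrite exprn_ge0//= exprn_ile1.
by move=> ?; rewrite exprn_ge0/= ?exprn_ile1//; lra.
Qed.

Lemma threshold_cvg1 t : 0 <= t -> t < 2^-1 ->
  threshold n t @[n --> \oo] --> (1 : R).
Proof.
move=> t0 t2; have t1 : 0 <= t <= 1 by lra.
apply: (@squeeze_cvgr _ _ _ _ (fun n => 1 - (2 * t) ^+ n) (cst 1)).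
- near=> n; apply/andP; split; last by have /andP[] := threshold_bounds n t1.
  have := @bernoulli_ineq (- t ^+ n) (2 ^ n) _.
  rewrite mulrN natrX -exprMn; apply.
  by rewrite lerN2 exprn_ile1//; lra.
- rewrite -[X in _ --> X]subr0; apply: cvgB; first exact: cvg_cst.
  by apply: cvg_expr; rewrite ger0_norm; lra.
- exact: cvg_cst.
Unshelve. all: by end_near. Qed.

Lemma threshold_cvg0 t : 2^-1 < t -> t <= 1 ->
  threshold n t @[n --> \oo] --> (0 : R).
Proof.
move=> t2 t1; have t01 : 0 <= t <= 1 by lra.
have t0 : 0 < t by lra.
apply: (@squeeze_cvgr _ _ _ _ (cst 0) (fun n => ((2 * t)^-1) ^+ n)).
- near=> n; apply/andP; split; first by have /andP[] := threshold_bounds n t01.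
  have tn0 : 0 < t ^+ n by rewrite exprn_gt0.
  have tn1 : t ^+ n <= 1 by rewrite exprn_ile1//; lra.
  rewrite exprVn -[leRHS]mul1r ler_pdivlMr ?exprn_gt0//; last by lra.
  (* [(1 + t ^+ n) ^+ (2 ^ n)] is at least [(2 * t) ^+ n], and its product with
     the threshold is a power of [1 - t ^+ n * t ^+ n]. *)
  have b := @bernoulli_ineq (t ^+ n) (2 ^ n) _.
  apply: (@le_trans _ _ (threshold n t * (1 + t ^+ n) ^+ (2 ^ n))).
    apply: ler_wpM2l; first by have /andP[] := threshold_bounds n t01.
    apply: le_trans (b _); last by lra.
    by rewrite natrX -exprMn lerDr.
  rewrite -exprMn (_ : (1 - _) * _ = 1 - (t ^+ n) * t ^+ n); last by ring.
  by apply: exprn_ile1; nra.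
- exact: cvg_cst.
- apply: cvg_expr; rewrite ger0_norm ?invr_ge0; last by lra.
  by rewrite invf_lt1; lra.
Unshelve. all: by end_near. Qed.

(** Dominated convergence; the level set [g x = 1 / 2], where the thresholds do
    not converge to the indicator, has to be null. *)
Lemma Rintegral_threshold_cvg d (T : measurableType d) (P : probability T R)
    (g : T -> R) :
  measurable_fun setT g -> (forall x, 0 <= g x <= 1) ->
  prob P [set x | g x = 2^-1] = 0 ->
  \int[P]_x threshold n (g x) @[n --> \oo] --> prob P [set x | g x < 2^-1].
Proof.
move=> mg g01 g0.
have mlt : measurable [set x | g x < 2^-1].
  rewrite -[X in measurable X]setTI.
  by apply: (@measurable_fun_ltr _ _ _ _ g (cst 2^-1)).
have meq : measurable [set x | g x = 2^-1].
  by have := mg measurableT [set 2^-1] (measurable_set1 _); rewrite setTI.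
have mth n : measurable_fun setT (fun x => threshold n (g x)).
  apply: measurable_funX; apply: measurable_funB => //.
  exact: measurable_funX.
have mind : measurable_fun setT
    (fun x => (\1_[set x | g x < 2^-1] x : R)%:E).
  by apply/measurable_EFinP; exact: measurable_indic.
have mEth n : measurable_fun setT (fun x => (threshold n (g x))%:E).
  exact/measurable_EFinP.
have cv : {ae P, forall x, setT x -> (threshold n (g x))%:E @[n --> \oo] -->
    (\1_[set x | g x < 2^-1] x : R)%:E}.
  exists [set x | g x = 2^-1]; split => //.
    by apply: etrans (probE _ meq) _; rewrite g0.
  move=> x /= nx; apply: contrapT => gx; apply: nx => _.
  apply: cvg_EFin; first exact: nearW.
  have /andP[g0x g1x] := g01 x.
  rewrite indicE; have [gl|gg|//] := ltgtP (g x) 2^-1.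
    by rewrite mem_set//; exact: threshold_cvg1.
  rewrite memNset; first exact: threshold_cvg0.
  by move=> /=; rewrite ltNge (ltW gg).
have i1 : P.-integrable setT (cst 1%E).
  by apply: bounded_mfun_integrable; exact: bounded_mfun_cst.
have bd : {ae P, forall x n, setT x ->
    (`|(threshold n (g x))%:E| <= cst 1 x)%E}.
  apply: aeW => x n _; rewrite /= lee_fin ger0_norm.
    by have /andP[] := threshold_bounds n (g01 x).
  by have /andP[] := threshold_bounds n (g01 x).
have [_ _] := dominated_convergence measurableT mEth mind cv i1 bd.
rewrite integral_indic// setIT => h; apply: fine_cvg.
by rewrite -probE.
Qed.

End Threshold.

(** * Fourier coefficients of the transformed laws *)

Section FourierCoefficients.
Context (R : realType) (c : nat).
Context (Q : 'I_c -> probability (measurableTypeR R) R) (p : 'I_c -> R).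
Hypotheses (acQ : forall l, ac_circular (Q l)).
Hypotheses (p_gt0 : forall l, 0 < p l) (p_sum : \sum_l p l = 1).

Let F := mix_fun Q p.
Let F_ge0 x : 0 <= F x := mix_fun_ge0 Q p_gt0 x.
Let F_le1 x : F x <= 1 := mix_fun_le1 Q p_gt0 p_sum x.

Definition wave (k : nat) (a u : R) : R := cos (2 * pi * k%:R * u - a).

Lemma wave_lipschitz k a u v :
  `|wave k a u - wave k a v| <= 2 * pi * k%:R * `|u - v|.
Proof.
apply: le_trans (cos_lipschitz _ _) _.
rewrite (_ : _ - _ = 2 * pi * k%:R * (u - v)); last by ring.
by rewrite normrM ger0_norm// !mulr_ge0// pi_ge0.
Qed.

Lemma wave_le1 k a u : `|wave k a u| <= 1. Proof. exact: cos_max. Qed.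

Lemma bounded_mfun_wave k a :
  bounded_mfun (fun x : measurableTypeR R => wave k a (F x)).
Proof.
split; last by exists 1 => x; exact: wave_le1.
apply: (@measurableT_comp _ _ _ _ _ _ (@cos R)).
  by apply: continuous_measurable_fun; exact: continuous_cos.
apply: measurable_funB; last exact: measurable_cst.
apply: measurable_funM; first exact: measurable_cst.
exact: mix_fun_measurable.
Qed.

(** A real Fourier coefficient of the law of [mix_fun] under [Q l]: letting the
    phase [a] vary covers both the cosine and the sine coefficients. *)
Definition fourier (l : 'I_c) (k : nat) (a : R) : R :=
  \int[Q l]_x wave k a (F x).

(** The cells of the partition of the circle by the quantiles of level
    [j / M] of the mixture; the last of the [M + 1] cells is the null set where
    [mix_fun] equals [1]. *)
Definition cell (M : nat) (x : R) : 'I_M.+1 :=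
  inord (Num.truncn (M%:R * F x)).

Lemma cellE M x : (cell M x : nat) = Num.truncn (M%:R * F x).
Proof.
rewrite inordK// ltnS truncn_le_nat (@le_lt_trans _ _ M%:R) ?ltr_nat//.
by rewrite ler_piMr.
Qed.

Lemma ltn_cell M x j : (0 < M)%N -> (cell M x < j)%N = (F x < j%:R / M%:R).
Proof.
move=> M0; rewrite cellE truncn_lt_nat ?mulr_ge0//.
by rewrite ltr_pdivlMr ?ltr0n// mulrC.
Qed.

Lemma cell_bounds M x : (0 < M)%N ->
  (cell M x)%:R / M%:R <= F x < (cell M x).+1%:R / M%:R.
Proof.
by move=> M0; rewrite -ltn_cell// ltnSn andbT leNgt -ltn_cell// ltnn.
Qed.

Lemma preimage_cell M j : (0 < M)%N ->
  cell M @^-1` [set j] =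
  [set x | F x < (j : nat).+1%:R / M%:R] `\`
  [set x | F x < (j : nat)%:R / M%:R].
Proof.
move=> M0; apply/seteqP; split => x /=.
  by move=> <-; rewrite -!ltn_cell// ltnSn ltnn.
rewrite -!ltn_cell// => -[xj /negP]; rewrite -leqNgt => jx.
by apply/val_inj/eqP; rewrite /= eqn_leq jx andbT -ltnS.
Qed.

Lemma measurable_cell M j : (0 < M)%N -> measurable (cell M @^-1` [set j]).
Proof.
by move=> M0; rewrite preimage_cell//; apply: measurableD;
  exact: measurable_mix_fun_lt.
Qed.

Lemma mix_prob_cell M (j : 'I_M.+1) : (0 < M)%N ->
  mix_prob Q p (cell M @^-1` [set j]) = ((j < M)%N)%:R / M%:R.
Proof.
move=> M0; have M0R : 0 < M%:R :> R by rewrite ltr0n.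
have m u := measurable_mix_fun_lt Q p_gt0 u.
rewrite preimage_cell// mix_prob_setDS//; last first.
  by move=> x /= /lt_le_trans; apply; rewrite ler_pM2r ?invr_gt0// ler_nat.
have jM : 0 <= ((j : nat)%:R / M%:R : R) <= 1.
  apply/andP; split; first by rewrite divr_ge0.
  by rewrite ler_pdivrMr// mul1r ler_nat -ltnS.
rewrite (mix_prob_lt acQ p_gt0 p_sum jM); case: (ltnP j M) => [jltM|Mj].
  rewrite (mix_prob_lt acQ p_gt0 p_sum)//.
    by rewrite -mulrBl -natr1 addrAC subrr add0r.
  apply/andP; split; first by rewrite divr_ge0.
  by rewrite ler_pdivrMr// mul1r ler_nat.
have -> : (j : nat) = M by apply/eqP; rewrite eqn_leq Mj andbT -ltnS.
rewrite (_ : [set x | _] = setT) ?mix_prob_setT//; last first.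
  apply/seteqP; split => // x _ /=; apply: le_lt_trans (F_le1 x) _.
  by rewrite ltr_pdivlMr// mul1r ltr_nat.
by rewrite divff ?gt_eqF// subrr mul0r.
Qed.

Lemma wave_rounding M k a x : (0 < M)%N ->
  `|wave k a (F x) - wave k a ((cell M x)%:R / M%:R)| <= 2 * pi * k%:R / M%:R.
Proof.
move=> M0; apply: le_trans (wave_lipschitz _ _ _ _) _.
apply: ler_wpM2l; first by rewrite !mulr_ge0// pi_ge0.
have /andP[h1 h2] := cell_bounds x M0.
rewrite ger0_norm ?subr_ge0// lerBlDl -[X in _ + X]mul1r -mulrDl natr1.
exact: ltW.
Qed.

Lemma fourier_rounding l M k a : (0 < M)%N ->
  `|fourier l k a - \sum_(j < M.+1)
      wave k a ((j : nat)%:R / M%:R) * prob (Q l) (cell M @^-1` [set j])|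
  <= 2 * pi * k%:R / M%:R.
Proof.
move=> M0; apply: (@Rintegral_rounding _ _ _ (Q l) M.+1 (cell M)
  (fun j => wave k a ((j : nat)%:R / M%:R))).
- by move=> j; exact: measurable_cell.
- exact: bounded_mfun_wave.
- by move=> x; exact: wave_rounding.
Qed.

(** Under the mixture, [mix_fun] is uniformly distributed, and the waves of
    positive frequency have mean zero against the uniform law. *)
Lemma mix_fourier_eq0 k a : (0 < k)%N -> \sum_l p l * fourier l k a = 0.
Proof.
move=> k0; apply/eqP; rewrite -normr_eq0; apply/eqP/le_anti.
rewrite normr_ge0 andbT; apply/ler_addgt0Pl => e e0; rewrite addr0.
(* The Riemann sums vanish for [M > k]; only the rounding error remains. *)
have [M /andP[kM Me]] : exists M : nat,
    (k < M)%N && (2 * pi * k%:R / M%:R <= e).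
  exists (maxn k.+1 (Num.truncn (2 * pi * k%:R / e)).+1).
  rewrite leq_maxl/=; set M := maxn _ _.
  have M0 : 0 < M%:R :> R by rewrite ltr0n (leq_trans _ (leq_maxl _ _)).
  rewrite ler_pdivrMr// [leRHS]mulrC -ler_pdivrMr// ltW//.
  apply: lt_le_trans (truncnS_gt _) _.
  by rewrite ler_nat leq_maxr.
apply: le_trans Me; have M0 : (0 < M)%N by rewrite (leq_trans _ kM).
have S0 : \sum_l p l * (\sum_(j < M.+1) wave k a ((j : nat)%:R / M%:R) *
    prob (Q l) (cell M @^-1` [set j])) = 0.
  under eq_bigr do rewrite mulr_sumr.
  rewrite exchange_big/=.
  rewrite (eq_bigr (fun j : 'I_M.+1 => wave k a ((j : nat)%:R / M%:R) *
      (((j < M)%N)%:R / M%:R))); last first.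
    move=> j _; rewrite -mix_prob_cell// mulr_sumr.
    by apply: eq_bigr => l _; ring.
  rewrite big_ord_recr/= ltnn mul0r mulr0 addr0.
  under eq_bigr do rewrite ltn_ord mulrC.
  by rewrite -mulr_sumr [X in _ * X]sum_cos_roots ?mulr0// k0.
rewrite -[X in `|X|]subr0 -[X in `| _ - X|]S0 -sumrB.
apply: le_trans (ler_norm_sum _ _ _) _.
rewrite -[leRHS]mul1r -[X in _ <= X * _]p_sum mulr_suml; apply: ler_sum => l _.
rewrite -mulrBr normrM gtr0_norm// ler_pM2l//.
exact: fourier_rounding.
Qed.

Section Uniqueness.
Context (l : 'I_c).
Hypothesis fourier0 : forall k a, (0 < k)%N -> fourier l k a = 0.

Let mix_int (f : R -> R) : R := \sum_l' p l' * \int[Q l']_x f x.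

Let agree (f : R -> R) : Prop := \int[Q l]_x f x = mix_int f.

Let agree_wave k a : agree (fun x => wave k a (F x)).
Proof.
rewrite /agree /mix_int; case: k => [|k].
  under eq_Rintegral do rewrite /wave mulr0 mul0r.
  rewrite Rintegral_cstT.
  under eq_bigr do under eq_Rintegral do rewrite /wave mulr0 mul0r.
  under eq_bigr do rewrite Rintegral_cstT.
  by rewrite -mulr_suml p_sum mul1r.
by rewrite [LHS]fourier0// [RHS]mix_fourier_eq0.
Qed.

Let agreeZ r f : bounded_mfun (f : measurableTypeR R -> R) -> agree f ->
  agree (fun x => r * f x).
Proof.
rewrite /agree /mix_int => bf E.
rewrite RintegralZl//; last exact: bounded_mfun_integrable.
rewrite E mulr_sumr; apply: eq_bigr => l' _.
rewrite RintegralZl//; last exact: bounded_mfun_integrable.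
by rewrite mulrCA.
Qed.

Let agreeD f g : bounded_mfun (f : measurableTypeR R -> R) ->
  bounded_mfun (g : measurableTypeR R -> R) -> agree f -> agree g ->
  agree (fun x => f x + g x).
Proof.
rewrite /agree /mix_int => bf bg Ef Eg.
rewrite RintegralD//; try exact: bounded_mfun_integrable.
rewrite Ef Eg -big_split; apply: eq_bigr => l' _ /=.
by rewrite RintegralD ?mulrDr//; exact: bounded_mfun_integrable.
Qed.

Let bounded_powM (f : measurableTypeR R -> R) n s : bounded_mfun f ->
  bounded_mfun (fun x => wave 1 s (F x) ^+ n * f x).
Proof.
move=> bf; elim: n => [|n IH].
  by under eq_fun do rewrite mul1r.
under eq_fun do rewrite exprS -mulrA.
by apply: bounded_mfunM => //; exact: bounded_mfun_wave.
Qed.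

(** Trigonometric polynomials are closed under multiplication by a wave of
    frequency one, by the product formula for cosines. *)
Let agree_pow_wave n s k a :
  agree (fun x => wave 1 s (F x) ^+ n * wave k a (F x)).
Proof.
elim: n k a => [|n IH] k a.
  by under eq_fun do rewrite mul1r; exact: agree_wave.
have [k' [b [b' E]]] : exists k' b b', forall x,
    wave 1 s (F x) ^+ n.+1 * wave k a (F x) =
    2^-1 * (wave 1 s (F x) ^+ n * wave k.+1 b (F x)) +
    2^-1 * (wave 1 s (F x) ^+ n * wave k' b' (F x)).
  case: k => [|k].
    exists 1%N, (s + a), (s - a) => x.
    rewrite exprSr -mulrA [wave 1 s _ * _]cosM2.
    transitivity (wave 1 s (F x) ^+ n *
      ((wave 1 (s + a) (F x) + wave 1 (s - a) (F x)) / 2)); last by field.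
    by congr (_ * ((_ + _) / 2)); congr cos; ring.
  exists k, (s + a), (a - s) => x; rewrite exprSr -mulrA [wave 1 s _ * _]cosM2.
  transitivity (wave 1 s (F x) ^+ n *
    ((wave k.+2 (s + a) (F x) + wave k (a - s) (F x)) / 2)); last by field.
  congr (_ * ((_ + _) / 2)); first by congr cos; rewrite -[in RHS]natr1; ring.
  by rewrite -cosN; congr cos; rewrite -[in LHS]natr1; ring.
under eq_fun do rewrite E.
apply: agreeD; try (apply: agreeZ; last exact: IH).
- apply: bounded_mfunM; first exact: bounded_mfun_cst.
  by apply: bounded_powM; exact: bounded_mfun_wave.
- apply: bounded_mfunM; first exact: bounded_mfun_cst.
  by apply: bounded_powM; exact: bounded_mfun_wave.
- by apply: bounded_powM; exact: bounded_mfun_wave.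
- by apply: bounded_powM; exact: bounded_mfun_wave.
Qed.

Let agree_poly (q : {poly R}) s : agree (fun x => q.[wave 1 s (F x)]).
Proof.
under eq_fun do rewrite horner_coef.
have bX n : bounded_mfun (fun x => wave 1 s (F x) ^+ n).
  have := bounded_powM n s (bounded_mfun_cst _ 1).
  by under eq_fun do rewrite mulr1.
have aX n : agree (fun x => wave 1 s (F x) ^+ n).
  have := agree_pow_wave n s 0 0.
  by under eq_fun do rewrite /wave mulr0 mul0r subr0 cos0 mulr1.
elim: (index_enum _) => [|i r IH].
  under eq_fun do rewrite big_nil.
  rewrite /agree /mix_int Rintegral_cstT.
  by under eq_bigr do rewrite Rintegral_cstT mulr0; rewrite big1.
under eq_fun do rewrite big_cons.
apply: agreeD => //.
- by apply: bounded_mfunM; [exact: bounded_mfun_cst|exact: bX].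
- apply: bounded_mfun_sum => j.
  by apply: bounded_mfunM; [exact: bounded_mfun_cst|exact: bX].
- exact: agreeZ (bX _) (aX _).
Qed.

(** Uniqueness of Fourier coefficients: trigonometric polynomials of the form
    [threshold n] composed with an affine image of a wave of frequency one
    approximate the indicator of the arc [0 < mix_fun < u]. *)
Lemma fourier_uniqueness u : 0 <= u <= 1 -> prob (Q l) [set x | F x < u] = u.
Proof.
move=> /andP[]; rewrite le_eqVlt => /predU1P[<- _|u0].
  apply: (mix_prob_eq0 p_gt0); apply: (mix_prob_lt acQ p_gt0 p_sum) => //.
  by rewrite lexx ler01.
rewrite le_eqVlt => /predU1P[->|u1].
  rewrite -(prob_mix_fun_leE acQ p_gt0 p_sum) ?lexx ?ler01//.
  rewrite (_ : [set x | _] = setT) ?prob_setT//.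
  by apply/seteqP; split => // x _ /=; exact: F_le1.
have u01 : 0 <= u <= 1 by rewrite !ltW.
(* The arc [0 < F < u] has center [u / 2], that is, phase [pi * u]; the affine
   map defining [g] sends the level [y0] to [1 / 2] and stays in the unit
   interval. *)
pose s : R := pi * u; pose y0 : R := cos s.
pose g x := 2^-1 - (wave 1 s (F x) - y0) / 4.
have waveE x : wave 1 s (F x) = cos (2 * pi * F x - pi * u).
  by rewrite /wave mulr1.
have g01 x : 0 <= g x <= 1.
  have := cos_max s; have := wave_le1 1 s (F x).
  by rewrite -/y0 !ler_norml /g; lra.
have mg : measurable_fun setT (g : measurableTypeR R -> R).
  apply: measurable_funB; first exact: measurable_cst.
  apply: measurable_funM; last exact: measurable_cst.
  apply: measurable_funB; last exact: measurable_cst.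
  exact: (bounded_mfun_wave 1 s).1.
have gcase x : [\/ F x \in [:: 0; u; 1] /\ g x = 2^-1,
    0 < F x < u /\ g x < 2^-1 | u < F x < 1 /\ 2^-1 < g x].
  rewrite /g !waveE /y0 /s.
  have := F_ge0 x; rewrite le_eqVlt => /predU1P[<-|x0].
    by apply: Or31; rewrite !inE eqxx cos_arc0 subrr; split => //; lra.
  have [xu|ux|->] := ltgtP (F x) u.
  - apply: Or32; split; first by rewrite x0.
    by have := @cos_arc_inside _ u (F x) u1; rewrite x0 xu => /(_ isT); lra.
  - have := F_le1 x; rewrite le_eqVlt => /predU1P[->|x1].
      apply: Or31; rewrite !inE eqxx !orbT cos_arc1 subrr; split => //; lra.
    apply: Or33; split; first by rewrite x1 andbT.
    by have := @cos_arc_outside _ u (F x) u0; rewrite ux x1 => /(_ isT); lra.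
  - apply: Or31; rewrite !inE eqxx !orbT cos_arcu subrr; split => //; lra.
have fib l' v : 0 <= v <= 1 -> prob (Q l') [set x | F x = v] = 0.
  move=> v01; have := prob_mix_fun_leE acQ p_gt0 p_sum l' v01.
  move/eqP; rewrite -subr_eq0 -prob_setDS.
  - move/eqP => <-; congr (prob _); apply/seteqP; split => x /=.
      by move=> Fx; rewrite -/(F x) Fx lexx ltxx.
    by move=> [h1 /negP]; rewrite -leNgt => h2; apply/le_anti/andP.
  - exact: measurable_mix_fun_lt.
  - exact: measurable_mix_fun_le.
  - by move=> x /= /ltW.
have mF v : measurable [set x | F x = v].
  have := mix_fun_measurable Q p_gt0 measurableT (measurable_set1 v).
  by rewrite setTI.
have g_null l' : prob (Q l') [set x | g x = 2^-1] = 0.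
  pose A v := [set x | F x = v].
  have mA v : measurable (A v) by exact: mF.
  have A0 v : 0 <= v <= 1 -> prob (Q l') (A v) = 0 by exact: fib.
  have m3 : measurable (A 0 `|` A u `|` A 1).
    by apply: measurableU; [apply: measurableU|]; exact: mA.
  have meq : measurable [set x | g x = 2^-1].
    by have := mg measurableT [set 2^-1] (measurable_set1 _); rewrite setTI.
  apply/le_anti; rewrite prob_ge0 andbT.
  apply: (@le_trans _ _ (prob (Q l') (A 0 `|` A u `|` A 1))).
    apply: prob_le => // x /= gx; case: (gcase x) => -[].
    - by rewrite !inE => /or3P[] /eqP h _; [left; left|left; right|right].
    - by rewrite gx ltxx.
    - by rewrite gx ltxx.
  have m2 : measurable (A 0 `|` A u) by apply: measurableU; exact: mA.
  apply: le_trans (prob_setU_le (Q l') m2 (mA 1)) _.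
  rewrite (A0 1) ?lexx ?ler01// addr0.
  apply: le_trans (prob_setU_le (Q l') (mA 0) (mA u)) _.
  by rewrite (A0 0) ?lexx ?ler01// A0 // addr0.
have arcE : [set x | g x < 2^-1] =
    [set x | F x < u] `\` [set x | F x <= 0].
  apply/seteqP; split => x /=.
    case: (gcase x) => -[] h1 h2 h3.
    - by move: h3; rewrite h2 ltxx.
    - by case/andP: h1 => h0 hu; split => //; apply/negP; rewrite -ltNge.
    - by move: (lt_trans h2 h3); rewrite ltxx.
  move=> [h1 /negP]; rewrite -ltNge => h0; case: (gcase x) => -[] //.
    rewrite !inE (gt_eqF h0) (lt_eqF h1) (lt_eqF (lt_trans h1 u1)).
    by [].
  by move=> /andP[h2]; move: (lt_trans h1 h2); rewrite ltxx.
have mlt := measurable_mix_fun_lt Q p_gt0 u.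
have mle := measurable_mix_fun_le Q p_gt0 0.
have sub : [set x | F x <= 0] `<=` [set x | F x < u].
  by move=> x /= /le_lt_trans; apply.
have z01 : 0 <= (0 : R) <= 1 by rewrite lexx ler01.
have mix_arc : mix_prob Q p [set x | g x < 2^-1] = u.
  rewrite arcE mix_prob_setDS// (mix_prob_lt acQ p_gt0 p_sum)//.
  rewrite (mix_prob_leq acQ p_gt0 p_sum)//.
  by rewrite subr0.
have prob_arc : prob (Q l) [set x | g x < 2^-1] = prob (Q l) [set x | F x < u].
  rewrite arcE prob_setDS// (prob_mix_fun_leE acQ p_gt0 p_sum)//.
  rewrite [X in _ - X](_ : _ = 0) ?subr0//.
  by apply: (mix_prob_eq0 p_gt0); exact: (mix_prob_lt acQ p_gt0 p_sum).
pose q n : {poly R} :=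
  (1 - ((2^-1 + y0 / 4)%:P - (4^-1)%:P * 'X) ^+ n) ^+ (2 ^ n).
have qE n x : (q n).[wave 1 s (F x)] = threshold n (g x).
  rewrite /q !hornerE /threshold /g; congr ((1 - _ ^+ _) ^+ _).
  by field.
have lim l' := Rintegral_threshold_cvg (P := Q l') mg g01 (g_null l').
rewrite -prob_arc -[RHS]mix_arc.
have lim_mix : \int[Q l]_x threshold n (g x) @[n --> \oo] -->
    mix_prob Q p [set x | g x < 2^-1]; last first.
  exact: (cvg_unique _ (lim l) lim_mix).
have -> : (fun n => \int[Q l]_x threshold n (g x)) =
    (fun n => mix_int (fun x => threshold n (g x))).
  apply/funext => n; have := agree_poly (q n) s; rewrite /agree.
  by under eq_fun do rewrite qE.
apply: cvg_big => [|l' _]; first exact: add_continuous.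
by apply: cvgM; [exact: cvg_cst|exact: lim].
Qed.

End Uniqueness.

End FourierCoefficients.

(** * Lower bounds for the statistic and empirical Fourier coefficients *)

Lemma natr_mul_sum (R : realType) (n : nat) (z : R) :
  n%:R * z = \sum_(i < n) z.
Proof. by rewrite sumr_const card_ord mulr_natl. Qed.

Section Statistic.
Context (R : realType) (phi : R -> R).
Hypotheses (hphi : is_kernel phi).
Hypotheses (hb : forall k : nat, (1 <= k)%N -> 0 < cheb_coef phi k).

Lemma sum_cos_diff_ge (n : nat) (u : 'I_n -> R) (k a : R) :
  (\sum_i cos (k * u i - a)) ^+ 2 <= \sum_i \sum_j cos (k * (u i - u j)).
Proof.
rewrite [leRHS](_ : _ = (\sum_i cos (k * u i - a)) ^+ 2 +
    (\sum_i sin (k * u i - a)) ^+ 2); first by rewrite lerDl sqr_ge0.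
rewrite !expr2 !mulr_suml -big_split/=; apply: eq_bigr => i _.
rewrite !mulr_sumr -big_split/=; apply: eq_bigr => j _.
by rewrite -cosB; congr cos; ring.
Qed.

(** All Chebyshev coefficients being positive, [S_stat] dominates the
    contribution of any single frequency, a positive multiple of
    the squared modulus of an empirical trigonometric moment, hence at least that
    multiple of the square of any real projection of the moment. *)
Lemma S_stat_ge (n : nat) (u : 'I_n -> R) (k : nat) (a : R) :
  (0 < k)%N -> (0 < n)%N ->
  n%:R * (cheb_coef phi k * (n%:R^-1 * \sum_i cos (k%:R * u i - a)) ^+ 2)
    <= S_stat phi u.
Proof.
move=> k0 n0; have n0R : 0 < n%:R :> R by rewrite ltr0n.
rewrite [leLHS](_ : _ = n%:R^-1 *
    (cheb_coef phi k * (\sum_i cos (k%:R * u i - a)) ^+ 2)); last first.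
  by field; rewrite gt_eqF.
rewrite /S_stat ler_pM2l ?invr_gt0//.
have cv : (\sum_i \sum_j (series (fun k => cheb_coef phi k.+1 *
    cos (k.+1%:R * (u i - u j))) m)) @[m --> \oo] -->
    \sum_i \sum_j phi (cos (u i - u j)).
  apply: cvg_big => [|i _]; first exact: add_continuous.
  apply: cvg_big => [|j _]; first exact: add_continuous.
  exact: kernel_expansion.
rewrite -(cvg_lim (@Rhausdorff R) cv); apply: limr_ge.
  by apply/cvg_ex; eexists; exact: cv.
near=> m; have km : (k <= m)%N by near: m; exact: nbhs_infty_ge.
have -> : \sum_i \sum_j series (fun k => cheb_coef phi k.+1 *
      cos (k.+1%:R * (u i - u j))) m =
    \sum_(h < m) cheb_coef phi h.+1 *
      \sum_i \sum_j cos (h.+1%:R * (u i - u j)).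
  under eq_bigr => i _ do under eq_bigr => j _ do rewrite /series/= big_mkord.
  under eq_bigr => i _ do rewrite exchange_big/=.
  rewrite exchange_big/=; apply: eq_bigr => h _.
  by rewrite mulr_sumr; apply: eq_bigr => i _; rewrite mulr_sumr.
have k1m : (k.-1 < m)%N by rewrite prednK.
rewrite (bigD1 (Ordinal k1m))//= prednK//.
apply: ler_wpDr; last first.
  by apply: ler_wpM2l; [rewrite ltW// hb|exact: sum_cos_diff_ge].
apply: sumr_ge0 => h _; rewrite mulr_ge0//; first by rewrite ltW// hb.
exact: le_trans (sqr_ge0 _) (sum_cos_diff_ge u h.+1%:R 0).
Unshelve. all: by end_near. Qed.

Lemma S_stat_ge0 (n : nat) (u : 'I_n -> R) : (0 < n)%N -> 0 <= S_stat phi u.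
Proof.
move=> n0; apply: le_trans (S_stat_ge u 0 (ltn0Sn 0) n0).
apply: mulr_ge0 => //; apply: mulr_ge0; last exact: sqr_ge0.
exact/ltW/hb.
Qed.

End Statistic.

Section EmpiricalFourier.
Context (R : realType) (c : nat).
Context (Q : 'I_c -> probability (measurableTypeR R) R) (p : 'I_c -> R).
Hypotheses (acQ : forall l, ac_circular (Q l)).
Hypotheses (p_gt0 : forall l, 0 < p l) (p_sum : \sum_l p l = 1).
Context (n : 'I_c -> nat) (x : forall l : 'I_c, 'I_(n l) -> R).
Arguments x : clear implicits.
Hypothesis (n_gt0 : forall l, (0 < n l)%N).
Context (M : nat) (e : R).
Hypothesis (M_gt0 : (0 < M)%N).

Let cel (y : R) : 'I_M.+1 := cell Q p M y.
Let N : R := (pooled_size n)%:R.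

Definition cell_freq (l : 'I_c) (j : 'I_M.+1) : R :=
  (n l)%:R^-1 * \sum_i \1_(cell Q p M @^-1` [set j]) (x l i).

Hypothesis freq_close :
  forall l j, `|cell_freq l j - prob (Q l) (cell Q p M @^-1` [set j])| <= e.
Hypothesis prop_close : forall l, `|(n l)%:R / N - p l| <= e.

Let eta : R := c%:R * (M.+1%:R * (e + e)).

Let M0 : 0 < M%:R :> R. Proof. by rewrite ltr0n. Qed.

Let n0 l : 0 < (n l)%:R :> R. Proof. by rewrite ltr0n. Qed.

Let nN l : (n l)%:R <= N.
Proof. by rewrite ler_nat /pooled_size (bigD1 l)//= leq_addr. Qed.

Let N0 (l : 'I_c) : 0 < N. Proof. exact: lt_le_trans (n0 l) (nN l). Qed.

Let e_ge0 (l : 'I_c) : 0 <= e.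
Proof. exact: le_trans (normr_ge0 _) (prop_close l). Qed.

Let eta_ge0 (l : 'I_c) : 0 <= eta.
Proof. by have := e_ge0 l => e0; rewrite !mulr_ge0// addr_ge0. Qed.

Let indic_cell j y : \1_(cell Q p M @^-1` [set j]) y = (cel y == j)%:R :> R.
Proof.
by rewrite indicE; case: eqP => h; [rewrite mem_set|rewrite memNset].
Qed.

Let rank_natr l (i : 'I_(n l)) :
  (pooled_rank x i)%:R =
  \sum_l' \sum_(i' < n l') ((x l' i' <= x l i)%R : nat)%:R :> R.
Proof.
rewrite /pooled_rank natr_sum; apply: eq_bigr => l' _.
rewrite -sum1_card natr_sum big_mkcond/=; apply: eq_bigr => i' _.
by rewrite inE; case: ifP.
Qed.

Let below (m : nat) : R :=
  \sum_l' \sum_(i' < n l') ((cel (x l' i') < m)%N : nat)%:R.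

(** The proportion of pooled observations in the first [m] cells is close to
    [m / M] because these cells have mass [m / M] under the mixture. *)
Let below_close (l : 'I_c) m : (m <= M)%N ->
  `|below m / N - m%:R / M%:R| <= eta.
Proof.
move=> mM.
have -> : below m / N = \sum_l' \sum_(j < M.+1 | (j < m)%N)
    ((n l')%:R / N * cell_freq l' j).
  rewrite /below mulr_suml; apply: eq_bigr => l' _.
  have freqE : \sum_(j < M.+1 | (j < m)%N) cell_freq l' j =
      (n l')%:R^-1 * \sum_(i < n l') ((cel (x l' i) < m)%N : nat)%:R.
    rewrite /cell_freq -mulr_sumr exchange_big/=; congr (_ * _).
    apply: eq_bigr => i _; under eq_bigr do rewrite indic_cell.
    rewrite big_mkcond/= (bigD1 (cel (x l' i)))//= eqxx big1 ?addr0.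
      by case: ifP.
    by move=> j jc; rewrite eq_sym (negPf jc) if_same.
  rewrite -mulr_sumr freqE; field.
  by rewrite !gt_eqF// (N0 l).
have -> : m%:R / M%:R = \sum_l' \sum_(j < M.+1 | (j < m)%N)
    (p l' * prob (Q l') (cell Q p M @^-1` [set j])).
  rewrite exchange_big/=.
  rewrite (eq_bigr (fun j : 'I_M.+1 => M%:R^-1)); last first.
    move=> j jm; have := mix_prob_cell acQ p_gt0 p_sum j M_gt0.
    by rewrite (leq_trans jm mM) mul1r.
  rewrite -(big_ord_widen _ (fun=> M%:R^-1) (leqW mM)).
  by rewrite sumr_const card_ord -[RHS]mulr_natl.
rewrite -sumrB; apply: le_trans (ler_norm_sum _ _ _) _.
rewrite /eta [leRHS]natr_mul_sum.
apply: ler_sum => l' _; rewrite -sumrB.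
apply: le_trans (ler_norm_sum _ _ _) _.
rewrite [leRHS]natr_mul_sum big_mkcond/=.
apply: ler_sum => j _; case: ifP => _; last by rewrite addr_ge0 ?e_ge0.
rewrite (_ : _ - _ = (n l')%:R / N *
    (cell_freq l' j - prob (Q l') (cell Q p M @^-1` [set j])) +
    ((n l')%:R / N - p l') * prob (Q l') (cell Q p M @^-1` [set j]));
  last by ring.
apply: le_trans (ler_normD _ _) _; rewrite !normrM; apply: lerD.
  rewrite -[leRHS]mul1r; apply: ler_pM => //.
  rewrite !ger0_norm ?invr_ge0 ?(ltW (N0 l))//.
  by rewrite ler_pdivrMr ?(N0 l)// mul1r.
rewrite -[leRHS]mulr1; apply: ler_pM => //.
rewrite ger0_norm ?prob_ge0//; apply: prob_le1.
exact: measurable_cell.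
Qed.

(** The rank lies between the numbers of observations in the cells strictly
    before, respectively up to, that of the observation. Past the last cell there
    is no [below_close]; there a rank is simply at most [N]. *)
Let rank_close l (i : 'I_(n l)) :
  `|(pooled_rank x i)%:R / N - (cel (x l i))%:R / M%:R| <= M%:R^-1 + eta.
Proof.
set j := cel _; have jM : (j <= M)%N by rewrite -ltnS.
have F_le := mix_fun_nondecreasing Q p_gt0.
have lo : below j / N <= (pooled_rank x i)%:R / N.
  rewrite ler_pM2r ?invr_gt0 ?(N0 l)// rank_natr.
  apply: ler_sum => l' _; apply: ler_sum => i' _; rewrite ler_nat.
  case: ltnP => // cj; rewrite lt0b; apply/ltW; rewrite ltNge.
  apply/negP => /F_le; rewrite leNgt => /negP; apply.
  have /andP[jF _] := cell_bounds Q p_gt0 p_sum (x l i) M_gt0.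
  apply: lt_le_trans jF.
  by rewrite -(ltn_cell Q p_gt0 p_sum).
have := below_close l jM; rewrite ler_distl => /andP[lo1 _].
have Mi : 0 < M%:R^-1 :> R by rewrite invr_gt0.
have [jltM|Mj] := ltnP j M.
  have hi : (pooled_rank x i)%:R / N <= below j.+1 / N.
    rewrite ler_pM2r ?invr_gt0 ?(N0 l)// rank_natr.
    apply: ler_sum => l' _; apply: ler_sum => i' _; rewrite ler_nat.
    case: leP => // xx; rewrite lt0b.
    rewrite (ltn_cell Q p_gt0 p_sum)//; apply: le_lt_trans (F_le _ _ xx) _.
    by have /andP[] := cell_bounds Q p_gt0 p_sum (x l i) M_gt0.
  have := below_close l jltM; rewrite ler_distl => /andP[_ hi1].
  rewrite ler_distl; apply/andP; split; first by lra.
  by move: hi1; rewrite -natr1 mulrDl mul1r; lra.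
have jE : (j : nat) = M by apply/eqP; rewrite eqn_leq jM.
have hi : (pooled_rank x i)%:R / N <= 1.
  rewrite ler_pdivrMr ?(N0 l)// mul1r ler_nat; apply: leq_sum => l' _.
  by apply: leq_trans (max_card _) _; rewrite card_ord.
move: lo1; rewrite ler_distl jE divff ?gt_eqF// => lo1.
rewrite jE in lo.
by have := eta_ge0 l => eta0; apply/andP; split; lra.
Qed.

(** The three error terms come from moving the scores to the corners of the
    cells, from replacing the cell frequencies by the cell probabilities, and
    from rounding in the integral [fourier]. *)
Lemma empirical_fourier l k a :
  `|(n l)%:R^-1 * \sum_i cos (k%:R * uniform_score x (l := l) i - a)
    - fourier Q p l k a| <=
  2 * pi * k%:R * (M%:R^-1 + eta) + M.+1%:R * e + 2 * pi * k%:R / M%:R.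
Proof.
have E1 : `|(n l)%:R^-1 * \sum_i cos (k%:R * uniform_score x (l := l) i - a) -
    (n l)%:R^-1 * \sum_i wave k a ((cel (x l i))%:R / M%:R)| <=
    2 * pi * k%:R * (M%:R^-1 + eta).
  rewrite -mulrBr -sumrB normrM ger0_norm ?invr_ge0//.
  rewrite ler_pdivrMl//; apply: le_trans (ler_norm_sum _ _ _) _.
  rewrite [leRHS]natr_mul_sum.
  apply: ler_sum => i _.
  rewrite (_ : cos _ = wave k a ((pooled_rank x i)%:R / N)); last first.
    by rewrite /wave /uniform_score -/N; congr cos; ring.
  apply: le_trans (wave_lipschitz _ _ _ _) _.
  apply: ler_wpM2l; last exact: rank_close.
  by rewrite !mulr_ge0// pi_ge0.
have E2 : (n l)%:R^-1 * \sum_i wave k a ((cel (x l i))%:R / M%:R) =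
    \sum_(j < M.+1) wave k a ((j : nat)%:R / M%:R) * cell_freq l j.
  rewrite /cell_freq; under [RHS]eq_bigr do rewrite mulrCA mulr_sumr.
  rewrite -mulr_sumr exchange_big/=; congr (_ * _); apply: eq_bigr => i _.
  rewrite (bigD1 (cel (x l i)))//= indic_cell eqxx mulr1 big1 ?addr0//.
  by move=> j jc; rewrite indic_cell eq_sym (negPf jc) mulr0.
have E3 : `|\sum_(j < M.+1) wave k a ((j : nat)%:R / M%:R) * cell_freq l j -
    \sum_(j < M.+1) wave k a ((j : nat)%:R / M%:R) *
      prob (Q l) (cell Q p M @^-1` [set j])| <= M.+1%:R * e.
  rewrite -sumrB; apply: le_trans (ler_norm_sum _ _ _) _.
  rewrite [leRHS]natr_mul_sum.
  apply: ler_sum => j _; rewrite -mulrBr normrM -[leRHS]mul1r.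
  by apply: ler_pM => //; exact: wave_le1.
have E4 := fourier_rounding Q p_gt0 p_sum l k a M_gt0.
rewrite E2 in E1; rewrite distrC in E4.
apply: le_trans (ler_distD _ _ _) (lerD _ E4).
exact: le_trans (ler_distD _ _ _) (lerD E1 E3).
Qed.

End EmpiricalFourier.

(** * From equal coefficients to equal laws, and the sampled frequencies *)

Lemma same_law_generator d (T : measurableType d) (R : realType)
    (P1 P2 : probability T R) (G : set (set T)) (g : nat -> set T) :
  measurable = <<s G >> -> setI_closed G -> (forall k, G (g k)) ->
  \bigcup_k g k = setT -> (forall A, G A -> prob P1 A = prob P2 A) ->
  same_law P1 P2.
Proof.
move=> mG GI Gg cover E A mA.
have mGA B : G B -> measurable B by rewrite mG; exact: sub_sigma_algebra.
apply: (measure_unique G g mG GI Gg cover) mA => [B GB|k].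
  apply: etrans (probE P1 (mGA _ GB)) (etrans _ (esym (probE P2 (mGA _ GB)))).
  by rewrite E.
by rewrite (le_lt_trans (probability_le1 _ (mGA _ (Gg k))))// ltry.
Qed.

Lemma same_law_distr_fun (R : realType)
    (Q1 Q2 : probability (measurableTypeR R) R) :
  distr_fun Q1 =1 distr_fun Q2 -> same_law Q1 Q2.
Proof.
move=> E A mA.
pose g (k : nat) : set R := `]- k%:R, +oo[%classic.
apply: (@same_law_generator _ _ R Q1 Q2 (RGenOInfty.G (R := R)) g) => //.
- exact: RGenOInfty.measurableE.
- move=> _ _ [x ->] [y ->]; exists (Num.max x y).
  by apply/seteqP; split => z; rewrite /= !in_itv/= !andbT gt_max => /andP.
- by move=> k; exists (- k%:R).
- apply/seteqP; split => // x _; exists (Num.truncn `|x|).+1 => //=.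
  rewrite /g/= in_itv/= andbT ltrNl.
  by apply: le_lt_trans (truncnS_gt _); rewrite -normrN ler_norm.
- by move=> _ [x ->]; rewrite -setCitvl !prob_setC// [prob _ _]E.
Qed.

(** If [F] is uniform under [Q l], then the event [y <= x] is squeezed between
    [F y < F x] and [F y <= F x], which both have probability [F x]. *)
Lemma fourier_eq0_distr_fun (R : realType) (c : nat)
    (Q : 'I_c -> probability (measurableTypeR R) R) (p : 'I_c -> R) l x :
  (forall l, ac_circular (Q l)) -> (forall l, 0 < p l) -> \sum_l p l = 1 ->
  (forall k a, (0 < k)%N -> fourier Q p l k a = 0) ->
  distr_fun (Q l) x = mix_fun Q p x.
Proof.
move=> acQ p_gt0 p_sum f0; set u := mix_fun Q p x.
have u01 : 0 <= u <= 1 by rewrite mix_fun_ge0// mix_fun_le1.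
have Elt := fourier_uniqueness acQ p_gt0 p_sum f0 u01.
have Ele := prob_mix_fun_leE acQ p_gt0 p_sum l u01.
apply/le_anti/andP; split.
  rewrite -[leRHS]Elt -Ele; apply: prob_le => //.
    exact: measurable_mix_fun_le.
  by move=> y /=; rewrite in_itv/=; exact: mix_fun_nondecreasing.
rewrite -[leLHS]Elt; apply: prob_le => //; first exact: measurable_mix_fun_lt.
move=> y /= yx; rewrite in_itv/= leNgt; apply/negP => /ltW xy.
by move: yx; rewrite ltNge mix_fun_nondecreasing.
Qed.

(** A single law cannot be the only one to have a nonzero coefficient, since
    the coefficients of the mixture vanish. *)
Lemma two_nonzero_fourier (R : realType) (c : nat)
    (Q : 'I_c -> probability (measurableTypeR R) R) (p : 'I_c -> R) :
  (forall l, ac_circular (Q l)) -> (forall l, 0 < p l) -> \sum_l p l = 1 ->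
  H1_fix Q ->
  exists l1 l2, l1 != l2 /\
    (exists k a, (0 < k)%N /\ fourier Q p l1 k a != 0) /\
    (exists k a, (0 < k)%N /\ fourier Q p l2 k a != 0).
Proof.
move=> acQ p_gt0 p_sum [i [j [_ Qij]]].
pose nz l := exists k a, (0 < k)%N /\ fourier Q p l k a != 0.
have nzPn l : ~ nz l -> forall k a, (0 < k)%N -> fourier Q p l k a = 0.
  move=> nl k a k0; apply/eqP/negPn/negP => f0.
  by apply: nl; exists k, a.
have [l1 nz1] : exists l1, nz l1.
  apply: contrapT => /forallNP all0; apply: Qij; apply: same_law_distr_fun => x.
  by rewrite !(fourier_eq0_distr_fun _ acQ p_gt0 p_sum)//; apply: nzPn.
have [l2 [l12 nz2]] : exists l2, l1 != l2 /\ nz l2.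
  apply: contrapT => /forallNP all0; case: nz1 => k [a [k0 /eqP]]; apply.
  have := mix_fourier_eq0 acQ p_gt0 p_sum a k0.
  rewrite (bigD1 l1)//= big1 ?addr0.
    by move/eqP; rewrite mulf_eq0 gt_eqF//= => /eqP.
  move=> l ll1; rewrite (nzPn l) ?mulr0// => nl.
  by apply: (all0 l); rewrite eq_sym.
by exists l1, l2.
Qed.

Lemma measurable_finite_fibers d (T : measurableType d) (I : finType)
    (f : T -> I) (A : set T) :
  (forall i, measurable (f @^-1` [set i])) ->
  (forall w w', f w = f w' -> A w -> A w') -> measurable A.
Proof.
move=> mf Af; rewrite (_ : A = \bigcup_(i in f @` A) f @^-1` [set i]).
  by apply: fin_bigcup_measurable => [|i _]; [exact: finite_finset|exact: mf].
apply/seteqP; split => [w Aw|w [_ [w' Aw' <-]] /= E].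
  by exists (f w) => //; exists w.
exact: Af Aw'.
Qed.

Section Samples.
Context d (T : measurableType d) (R : realType) (P : probability T R).
Context (c : nat) (n : 'I_c -> nat).
Context (X : forall l : 'I_c, 'I_(n l) -> {RV P >-> R}).
Arguments X : clear implicits.

Let idx := {l : 'I_c & 'I_(n l)}.
Let Y (s : idx) : {RV P >-> R} := X (tag s) (tagged s).

(** The scores depend on the pooled sample only through the finitely many
    possible order patterns. *)
Lemma measurable_T_stat_gt (phi : R -> R) (m : 'rV[R]_c -> R) t :
  measurable [set w | t < T_stat phi m (fun l i => X l i w)].
Proof.
pose f w : {ffun idx * idx -> bool} := [ffun s => Y s.1 w <= Y s.2 w].
apply: (@measurable_finite_fibers _ _ _ f).
  move=> b; rewrite (_ : _ @^-1` _ =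
      \bigcap_(s in [set: idx * idx]) [set w | (Y s.1 w <= Y s.2 w) = b s]).
    apply: fin_bigcap_measurable => [|s _]; first exact: finite_finset.
    have mle : measurable [set w | Y s.1 w <= Y s.2 w].
      rewrite -[X in measurable X]setTI.
      exact: (@measurable_fun_ler _ _ _ _ (Y s.1) (Y s.2)).
    case: (b s) => //.
    rewrite (_ : [set w | _] = ~` [set w | Y s.1 w <= Y s.2 w]).
      exact: measurableC.
    by apply/seteqP; split => w /= => [->|/negP/negbTE].
  apply/seteqP; split => w /=.
    by move=> <- s _ /=; rewrite ffunE.
  by move=> E; apply/ffunP => s; rewrite ffunE; exact: E.
move=> w w' E /=; rewrite /T_stat.
suff -> : (\row_l S_stat phi (uniform_score (fun l i => X l i w) (l := l))) =
  (\row_l S_stat phi (uniform_score (fun l i => X l i w') (l := l))) by [].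
apply/rowP => l; rewrite !mxE; congr (S_stat _ _); apply/funext => i.
rewrite /uniform_score; congr (_ * _%:R / _); rewrite /pooled_rank.
apply: eq_bigr => l' _; apply: eq_card => i'; rewrite !inE.
have := congr1 (fun g : {ffun idx * idx -> bool} =>
  g (Tagged (fun l => 'I_(n l)) i', Tagged (fun l => 'I_(n l)) i)) E.
by rewrite !ffunE.
Qed.

Context (Q : 'I_c -> probability (measurableTypeR R) R).
Hypothesis (hX : circular_samples Q X).

Lemma measurable_sample_deviation (l : 'I_c) (B : set R) (e : R) :
  measurable B ->
  measurable
    [set w | e < `|(n l)%:R^-1 * (\sum_i \1_B (X l i w)) - prob (Q l) B|].
Proof.
move=> mB; rewrite -[X in measurable X]setTI.
apply: (@measurable_fun_ltr _ _ _ _ (cst e)) => //.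
apply: measurableT_comp => //; apply: measurable_funB => //.
apply: measurable_funM => //.
apply: (@bounded_mfun_sum _ _ _ _ _ (fun i w => \1_B (X l i w)) _).1 => i.
by apply: bounded_mfun_indic; exact: (measurable_funPTI (X l i) mB).
Qed.

Lemma sample_frequency_deviation (l : 'I_c) (B : set R) (e : R) :
  (0 < n l)%N -> 0 < e -> measurable B ->
  prob P [set w | e < `|(n l)%:R^-1 * (\sum_i \1_B (X l i w)) - prob (Q l) B|]
    <= ((n l)%:R * e ^+ 2)^-1.
Proof.
move=> n0 e0 mB; have [_ law ind] := hX.
have mX i : measurable (X l i @^-1` B) by exact: measurable_funPTI.
have PX i : prob P (X l i @^-1` B) = prob (Q l) B.
  by rewrite /prob -(law l i B mB).
apply: (@frequency_deviation _ _ _ _ _ (fun i => X l i @^-1` B)) => // i j ij.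
pose s := Tagged (fun l => 'I_(n l)) i; pose s' := Tagged (fun l => 'I_(n l)) j.
have ss' : s != s' by rewrite -tag_eqE /tag_eq eqxx tagged_asE.
have := ind [set s; s']%SET (fun=> B) (fun=> mB).
rewrite (big_setD1 s)/= ?inE ?eqxx//.
rewrite (_ : ([set s; s'] :\ s)%SET = [set s']%SET).
  rewrite big_set1 (_ : \bigcap_(_ in _) _ = X l i @^-1` B `&` X l j @^-1` B).
    move=> E; apply: EFin_inj; rewrite -probE; last exact: measurableI.
    by rewrite E EFinM -{1}(PX i) -(PX j) -!probE.
  apply/seteqP; split => w.
    by move=> h; split; [apply: (h s)|apply: (h s')];
      rewrite /= !inE eqxx ?orbT.
  by move=> [h1 h2] u /=; rewrite !inE => /orP[] /eqP ->.
apply/setP => u; rewrite !inE; have [->|] := eqVneq u s => //=.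
by rewrite (negPf ss').
Qed.

End Samples.

(** [N%:R^-1 * m (N%:R *: x)] has a positive limit, so [m (N%:R *: x)] grows
    linearly. *)
Lemma merging_divergence (R : realType) (c : nat) (m : 'rV[R]_c -> R)
    (x : 'rV[R]_c) (t : R) : is_merging m -> (forall l, 0 <= x 0 l) ->
  (exists l1 l2, [/\ l1 != l2, 0 < x 0 l1 & 0 < x 0 l2]) ->
  \forall N \near \oo, t < m (N%:R *: x).
Proof.
move=> hm x0 xpos; have [moo moo_lim moo_gt0] := merging_limit hm.
have m0 := moo_gt0 x x0 xpos.
have lim : \forall N \near \oo, moo x / 2 < N%:R^-1 * m (N%:R *: x).
  by apply: (cvgr_gt (moo x)); [exact: moo_lim|lra].
near=> N.
have N0 : 0 < N%:R :> R.
  by rewrite ltr0n; near: N; exact: nbhs_infty_gt.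
have Nt : 2 * t / moo x <= N%:R by near: N; exact: nbhs_infty_ger.
have h : moo x / 2 < N%:R^-1 * m (N%:R *: x) by near: N.
rewrite ltr_pdivlMl// in h.
apply: le_lt_trans h; move: Nt; rewrite ler_pdivrMr//; lra.
Unshelve. all: by end_near. Qed.

(** The number of cells is chosen first, which bounds the discretization error,
    and then the tolerance on the cell frequencies. *)
Lemma exists_resolution (R : realType) (c : nat) (K z : R) : 0 <= K -> 0 < z ->
  exists (M : nat) (e : R), [/\ (0 < M)%N, 0 < e &
    K * (M%:R^-1 + c%:R * (M.+1%:R * (e + e))) + M.+1%:R * e + K / M%:R <= z].
Proof.
move=> K0 z0; pose M := (Num.truncn (4 * K / z)).+1.
have M0 : 0 < M%:R :> R by rewrite ltr0n.
have KM : K / M%:R <= z / 4.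
  rewrite ler_pdivrMr//; have : 4 * K / z < M%:R by exact: truncnS_gt.
  by rewrite ltr_pdivrMr//; lra.
pose B : R := K * (c%:R * (M.+1%:R * 2)) + M.+1%:R.
have B0 : 0 < B by rewrite ltr_wpDl ?ltr0n// !mulr_ge0.
exists M, (z / (2 * B)); split => //; first by rewrite divr_gt0// mulr_gt0.
rewrite (_ : _ + _ = 2 * (K / M%:R) + B * (z / (2 * B))); last first.
  by rewrite /B; ring.
rewrite (_ : B * _ = z / 2); last by field; rewrite gt_eqF.
lra.
Qed.

(** * The limit regime and consistency *)

Section LimitRegime.
Context (R : realType) (c : nat) (n : nat -> 'I_c -> nat) (p : 'I_c -> R).
Hypotheses (hn : forall k l, (2 <= n k l)%N).
Hypotheses (hN : (fun k => pooled_size (n k)) @ \oo --> \oo).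
Hypotheses (hnp : forall l,
  (fun k => (n k l)%:R / (pooled_size (n k))%:R : R) @ \oo --> p l).

Lemma pooled_size_gt0 (l : 'I_c) k : (0 < pooled_size (n k))%N.
Proof.
by rewrite /pooled_size (bigD1 l)//= ltn_addr// (leq_trans _ (hn k l)).
Qed.

Lemma sum_limit_proportions (l : 'I_c) : \sum_l p l = 1.
Proof.
have lim : (fun k => \sum_l (n k l)%:R / (pooled_size (n k))%:R : R) @ \oo -->
    \sum_l p l.
  by apply: cvg_big => [|i _]; [exact: add_continuous|exact: hnp].
suff E : (fun k => \sum_l (n k l)%:R / (pooled_size (n k))%:R : R) = fun=> 1.
  rewrite E in lim.
  have lim1 : (fun=> 1 : R) @ \oo --> (1 : R) by exact: cvg_cst.
  exact: (cvg_unique _ lim lim1).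
apply/funext => k; rewrite -mulr_suml -natr_sum divff//.
by rewrite pnatr_eq0 -lt0n (pooled_size_gt0 l).
Qed.

Lemma cvg_inv_sample_size (l : 'I_c) : 0 < p l ->
  (fun k => (n k l)%:R^-1 : R) @ \oo --> (0 : R).
Proof.
move=> p0.
have Ninv : (fun k => (pooled_size (n k))%:R^-1 : R) @ \oo --> (0 : R).
  apply/gtr0_cvgV0; last exact/cvgrnyP.
  by near=> k; rewrite ltr0n (pooled_size_gt0 l).
rewrite (_ : (fun k => _) = fun k => ((n k l)%:R / (pooled_size (n k))%:R)^-1 *
    (pooled_size (n k))%:R^-1); last first.
  apply/funext => k; rewrite invf_div mulrAC divff ?mul1r//.
  by rewrite pnatr_eq0 -lt0n (pooled_size_gt0 l).
rewrite -[X in _ --> X](mulr0 (p l)^-1); apply: cvgM => //.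
by apply: cvgV; [rewrite gt_eqF|exact: hnp].
Unshelve. all: by end_near. Qed.

End LimitRegime.

Theorem corollary6p1 (R : realType) (c : nat) (hc : (2 <= c)%N)
  (m : 'rV[R]_c -> R) (hm : is_merging m)
  (phi : R -> R) (hphi : is_kernel phi)
  (hb : forall k : nat, (1 <= k)%N -> 0 < cheb_coef phi k)
  (Q : 'I_c -> probability (measurableTypeR R) R)
  (hQ : forall l, ac_circular (Q l))
  (hH1 : H1_fix Q)
  (n : nat -> 'I_c -> nat) (hn : forall k l, (2 <= n k l)%N)
  (hN : (fun k => pooled_size (n k)) @ \oo --> \oo)
  (p : 'I_c -> R) (hp : forall l, 0 < p l < 1)
  (hnp : forall l,
    (fun k => (n k l)%:R / (pooled_size (n k))%:R : R) @ \oo --> p l)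
  (d : nat -> measure_display) (Omega : forall k, measurableType (d k))
  (P : forall k, probability (Omega k) R)
  (Theta : forall k (l : 'I_c), 'I_(n k l) -> {RV (P k) >-> R})
  (hTheta : forall k, circular_samples Q (Theta k))
  (t : R) :
  (fun k => P k [set w | t < T_stat phi m (fun l i => Theta k l i w)])
    @ \oo --> 1%:E.
Proof.
have p_gt0 l : 0 < p l by have /andP[] := hp l.
pose l0 : 'I_c := Ordinal (ltnW hc).
have p_sum : \sum_l p l = 1 by exact: (sum_limit_proportions hn hnp l0).
have n_gt0 k l : (0 < n k l)%N by rewrite (leq_trans _ (hn k l)).
have [l1 [l2 [l12 [[k1 [a1 [k1_gt0 f1]]] [k2 [a2 [k2_gt0 f2]]]]]]] :=
  two_nonzero_fourier hQ p_gt0 p_sum hH1.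
set z1 := fourier Q p l1 k1 a1 in f1; set z2 := fourier Q p l2 k2 a2 in f2.
have z1_gt0 : 0 < `|z1| by rewrite normr_gt0.
have z2_gt0 : 0 < `|z2| by rewrite normr_gt0.
pose K : R := 2 * pi * (k1 + k2)%:R.
have pi_0 := pi_ge0 R.
have K_ge0 : 0 <= K by rewrite !mulr_ge0.
(* Empirical moments within [z] of [z1] and [z2] are at least half as large. *)
pose z := Num.min (`|z1| / 2) (`|z2| / 2).
have z_gt0 : 0 < z by rewrite lt_min !divr_gt0.
have [M [e [M_gt0 e_gt0 res]]] := exists_resolution c K_ge0 z_gt0.
pose B (j : 'I_M.+1) : set R := cell Q p M @^-1` [set j].
have mB j : measurable (B j) by exact: measurable_cell.
pose bad k (s : 'I_c * 'I_M.+1) : set (Omega k) :=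
  [set w | e < `|(n k s.1)%:R^-1 * (\sum_i \1_(B s.2) (Theta k s.1 i w))
                 - prob (Q s.1) (B s.2)|].
have mbad k s : measurable (bad k s) by exact: measurable_sample_deviation.
(* Asymptotic lower bounds for the two statistics divided by [N]; the factor
   [1 / 2] on [p l] absorbs the fluctuation of [n k l / N]. *)
pose s1 : R := p l1 / 2 * (cheb_coef phi k1 * (`|z1| / 2) ^+ 2).
pose s2 : R := p l2 / 2 * (cheb_coef phi k2 * (`|z2| / 2) ^+ 2).
have s1_gt0 : 0 < s1.
  by rewrite mulr_gt0 ?divr_gt0// mulr_gt0 ?exprn_gt0 ?divr_gt0// hb.
have s2_gt0 : 0 < s2.
  by rewrite mulr_gt0 ?divr_gt0// mulr_gt0 ?exprn_gt0 ?divr_gt0// hb.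
pose v : 'rV[R]_c := \row_l (if l == l1 then s1 else if l == l2 then s2 else 0).
have v_ge0 l : 0 <= v 0 l.
  by rewrite mxE; case: ifP => _; [exact: ltW|case: ifP => _ //; exact: ltW].
have v_gt0 : exists l l', [/\ l != l', 0 < v 0 l & 0 < v 0 l'].
  by exists l1, l2; rewrite !mxE eqxx [l2 == l1]eq_sym (negPf l12) eqxx.
have good : \forall k \near \oo, forall w : Omega k,
    (forall s, ~ bad k s w) -> t < T_stat phi m (fun l i => Theta k l i w).
  have prop_close : \forall k \near \oo, forall l,
      `|(n k l)%:R / (pooled_size (n k))%:R - p l| <= e.
    apply: filter_forall => l; move/cvgrPdist_le: (hnp l) => /(_ e e_gt0).
    by apply: filterS => k; rewrite distrC.
  have prop_half : \forall k \near \oo, forall l,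
      p l / 2 < (n k l)%:R / (pooled_size (n k))%:R.
    apply: filter_forall => l; apply: (cvgr_gt (p l)); first exact: hnp.
    by have := p_gt0 l; lra.
  have diverges := hN _ (merging_divergence t hm v_ge0 v_gt0).
  near=> k => w nbad.
  have N_gt0 : 0 < (pooled_size (n k))%:R :> R.
    by rewrite ltr0n (pooled_size_gt0 hn l0).
  have close : forall l, `|(n k l)%:R / (pooled_size (n k))%:R - p l| <= e.
    by near: k.
  have half : forall l, p l / 2 < (n k l)%:R / (pooled_size (n k))%:R.
    by near: k.
  have tm : t < m ((pooled_size (n k))%:R *: v) by near: k.
  apply: lt_le_trans tm _; apply: merging_increasing => // l.
  pose x l (i : 'I_(n k l)) : R := Theta k l i w.
  have freq l' j : `|cell_freq Q p x l' j - prob (Q l') (B j)| <= e.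
    by rewrite leNgt; apply/negP; exact: (nbad (l', j)).
  have emp l' k' a' : (k' <= k1 + k2)%N ->
      `|(n k l')%:R^-1 * \sum_i cos (k'%:R * uniform_score x (l := l') i - a')
        - fourier Q p l' k' a'| <= z.
    move=> k'K; apply: le_trans res.
    apply: le_trans (empirical_fourier hQ p_gt0 p_sum (n_gt0 k) M_gt0 freq close
      l' k' a') _.
    have k'le : 2 * pi * k'%:R <= K.
      by apply: ler_wpM2l; rewrite ?mulr_ge0// ler_nat.
    apply: lerD; last by apply: ler_wpM2r.
    rewrite lerD2r; apply: ler_wpM2r => //.
    by rewrite addr_ge0// !mulr_ge0// addr_ge0// ltW.
  have lower l' k' a' : (0 < k')%N -> (k' <= k1 + k2)%N ->
      z <= `|fourier Q p l' k' a'| / 2 ->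
      (pooled_size (n k))%:R * (p l' / 2 * (cheb_coef phi k' *
        (`|fourier Q p l' k' a'| / 2) ^+ 2)) <=
      S_stat phi (uniform_score x (l := l')).
    move=> k'0 k'K zf.
    apply: le_trans (S_stat_ge hphi hb _ a' k'0 (n_gt0 k l')).
    have bk := ltW (hb k' k'0); rewrite mulrA; apply: ler_pM.
    - by rewrite mulr_ge0// divr_ge0// ltW.
    - by rewrite mulr_ge0// sqr_ge0.
    - by have := half l'; rewrite ltr_pdivlMr// mulrC => /ltW.
    - apply: ler_wpM2l => //; rewrite -[leRHS](real_normK (num_real _)).
      apply: lerXn2r; rewrite ?nnegrE ?divr_ge0//.
      have := emp l' k' a' k'K; set y := _ * \sum_i _.
      set f := fourier _ _ _ _ _.
      move=> yf; have := ler_distD y f 0; rewrite !subr0 [`|f - y|]distrC.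
      by move: zf; rewrite -/f; lra.
  rewrite !mxE; have [->|ll1] := eqVneq l l1.
    by apply: lower => //; [rewrite leq_addr|rewrite ge_min lexx].
  have [->|ll2] := eqVneq l l2.
    by apply: lower => //; [rewrite leq_addl|rewrite ge_min lexx orbT].
  by rewrite mulr0; exact: S_stat_ge0.
(* The bad events have total probability at most a finite sum of Chebyshev
   bounds, each of the order of [(n k l)^-1]. *)
pose A k := [set w : Omega k | t < T_stat phi m (fun l i => Theta k l i w)].
have mA k : measurable (A k) by exact: measurable_T_stat_gt.
rewrite (_ : (fun k => _) = fun k => (prob (P k) (A k))%:E); last first.
  by apply/funext => k; rewrite -probE.
have bound0 : (fun k => \sum_(s : 'I_c * 'I_M.+1)
    ((n k s.1)%:R * e ^+ 2)^-1 : R) @ \oo --> (0 : R).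
  have E0 : \sum_(s : 'I_c * 'I_M.+1) (0 * e ^- 2) = 0 :> R.
    by rewrite big1// => s _; rewrite mul0r.
  rewrite -[X in _ --> X]E0.
  apply: cvg_big => [|s _]; first exact: add_continuous.
  under eq_fun do rewrite invfM.
  apply: cvgM; last exact: cvg_cst.
  exact: (cvg_inv_sample_size hn hN hnp).
apply: cvg_EFin; first exact: nearW.
apply: (@squeeze_cvgr _ _ _ _
  (fun k => 1 - \sum_(s : 'I_c * 'I_M.+1) ((n k s.1)%:R * e ^+ 2)^-1) (cst 1)).
- near=> k; apply/andP; split; last exact: prob_le1.
  have mU : measurable (\big[setU/set0]_(s : 'I_c * 'I_M.+1) bad k s).
    exact: bigsetU_measurable.
  apply: (@le_trans _ _ (prob (P k) (~` \big[setU/set0]_s bad k s))).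
    rewrite prob_setC// lerD2l lerN2.
    apply: le_trans (prob_bigsetU_le _ (mbad k)) _.
    apply: ler_sum => s _; exact: sample_frequency_deviation.
  apply: prob_le => //; first exact: measurableC.
  move=> w nw; have Gk : forall w : Omega k, (forall s, ~ bad k s w) ->
      t < T_stat phi m (fun l i => Theta k l i w) by near: k.
  apply: Gk => s bs; apply: nw; rewrite -bigcup_seq/=.
  by exists s => //=; rewrite mem_index_enum.
- by have := cvgB (cvg_cst (1 : R)) bound0; rewrite subr0; exact.
- exact: cvg_cst.
Unshelve. all: by end_near. Qed.
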